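(* Let $B\subset W$ be a good lattice. The splitting over $K_B$ given by $g\longmapsto (g,S_\psi^B(g))$, $K_B\to\widehat{Sp(W)}_\psi^B$, takes its values in the metaplectic group $Mp(W)$ of $W$, i.e. in the subgroup $Mp(W)_\psi^B$ of $\widehat{Sp(W)}_\psi^B$.
   Context: $k$ is a non-archimedean local field of characteristic $0$ with ring of integers $\mathcal{O}$, uniformizer $\varpi$, residue field $\mathbb{F}_q$ of characteristic $p\neq2$; $\psi$ is a non-trivial unitary character of $(k,+)$ with conductor $\lambda_\psi$ ($\psi$ is trivial on $\varpi^{\lambda_\psi}\mathcal{O}$ but not on $\varpi^{\lambda_\psi-1}\mathcal{O}$); $\overline\psi$ is the character of $\mathbb{F}_q$ with $\overline\psi(x\bmod\varpi)=\psi(\varpi^{\lambda_\psi-1}x)$. $(W,\beta)$ is a symplectic $k$-space of dimension $2r>0$. A lattice is a compact open $\mathcal{O}$-submodule; $B^*=\{v\in W:\beta(v,b)\in\varpi^{\lambda_\psi}\mathcal{O}\ \forall b\in B\}$; $B$ is good if $\varpi B^*\subset B\subset B^*$, self-dual if $B=B^*$. $K_B$ is the stabilizer of $B$ in $Sp(W)$. $\mathrm{b}^*=B^*/B$ is an $\mathbb{F}_q$-space with symplectic form $\beta_{\mathrm{b}^*}(\bar v,\bar w)=\varpi^{1-\lambda_\psi}\beta(v,w)\bmod\varpi$, of dimension $2l$; $p_{Sp(\mathrm{b}^* )}:K_B\to Sp(\mathrm{b}^* )$ is the induced morphism. **Heisenberg and metaplectic groups.** For a symplectic space $(V,\beta)$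 over a field $F$ ($F=k$ or $\mathbb F_q$), $H(V)=V\times F$ with $(w,t)(w',t')=(w+w',t+t'+\frac12\beta(w,w'))$; $Sp(V)$ acts by $g.(w,t)=(gw,t)$. $\rho_\psi$ is the unique irreducible unitary representation with central character $\psi$. Given a model of $\rho_\psi$ on a Hilbert space $\mathcal{H}$, $\widehat{Sp(V)}_\psi$ is the group of pairs $(g,U)\in Sp(V)\times U(\mathcal{H})$ with $U\rho_\psi(h)U^{-1}=\rho_\psi(g.h)$ for all $h$. For $F=k$, $Mp(W)_\psi$ is the unique subgroup of $\widehat{Sp(W)}_\psi$ on which the projection to $Sp(W)$ is surjective with kernel of order $2$; it is canonically identified with the metaplectic double cover $Mp(W)$. **Canonical Weil representation over $\mathbb{F}_q$.** Let $\mathrm{x}\subset \mathrm{b}^*$ be a Lagrangian and $\mathcal{H}^{\mathrm{x}}_{\overline\psi}$ the space of functions $\varphi:\mathrm{b}^*\to\mathbb{C}$ with $\varphi(a+w)=\overline\psi(\frac12\beta_{\mathrm b^*}(w,a))\varphi(w)$, $a\in\mathrm{x}$; $H(\mathrm{b}^* )$ acts by $\rho_{\overline\psi}(w,t)\varphi(w')=\overline\psi(t+\frac12\beta_{\mathrm b^*}(w',w))\varphi(w'+w)$. Put $j(g)=l-\dim(\mathrm{x}\cap g\mathrm{x})$, $\omega(a)=q^{-1/2}\sum_{t\in\mathbb{F}_q}\overline\psi(\frac12at^2)$ (which depends only on $a$ mod squares), and let $\theta:Sp(\mathrm{b}^* )\to\mathbb{F}_q^\times/(\mathbb{F}_q^\times)^2$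 be the function with $\theta(p_1gp_2)=\theta(p_1)\theta(g)\theta(p_2)$ for $p_1,p_2$ in the stabilizer $P$ of $\mathrm{x}$, $\theta(p)=\det(p_{|\mathrm{x}})$ for $p\in P$, and $\theta(\tau_S)=1$ for $S\subset\{1,\dots,l\}$, where, for a symplectic basis $(e_i,f_i)$ with $e_i$ spanning $\mathrm{x}$, $\tau_S e_i=f_i,\ \tau_Sf_i=-e_i$ for $i\in S$ and $\tau_S$ fixes $e_i,f_i$ for $i\notin S$. Put $m(g)=\omega(\theta(g))^{-1}\omega(1)^{1-j(g)}$. The canonical Weil representation is $$S_{\overline\psi}(g)\varphi(w)=m(g)q^{j(g)/2}\,q^{-l}\sum_{x\in\mathrm{x}}\overline\psi(\tfrac12\beta_{\mathrm b^*}(x,w))\varphi(g^{-1}(w+x)).$$ **Generalized lattice model.** Let $\mathcal{H}_{\overline\psi}$ be the space of $\rho_{\overline\psi}$ and $S_{\overline\psi}$. Let $\widetilde\rho_{\overline\psi}(b,t)=\psi(t)\rho_{\overline\psi}(b+B,0)$ for $(b,t)\in B^*\times k$ (write $\widetilde\rho_{\overline\psi}(b)=\widetilde\rho_{\overline\psi}(b,0)$), and $\widetilde S_{\overline\psi}=S_{\overline\psi}\circ p_{Sp(\mathrm{b}^* )}$. $\mathcal{H}^B_\psi$ is the Hilbert space of functions $\varphi:W\to\mathcal{H}_{\overline\psi}$ with $\varphi(b+w)=\psi(\frac12\beta(w,b))\widetilde\rho_{\overline\psi}(b)\varphi(w)$ ($b\in B^*$) and $\int_{W/B^*}\|\varphi\|^2<\infty$;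 $\rho_\psi^B(w,t)\varphi(w')=\psi(t+\frac12\beta(w',w))\varphi(w'+w)$ is a model of $\rho_\psi$. $\widehat{Sp(W)}_\psi^B$ and $Mp(W)_\psi^B$ are the groups above for this model. For $g\in K_B$, $S^B_\psi(g)\varphi(w)=\widetilde S_{\overline\psi}(g)[\varphi(g^{-1}w)]$; $g\mapsto(g,S_\psi^B(g))$ is a group homomorphism $K_B\to\widehat{Sp(W)}_\psi^B$ that is a section of the projection onto $Sp(W)$ over $K_B$. *)

(* Defs.v *)
From HB Require Import structures.
From mathcomp Require Import all_boot all_order all_algebra all_field.
From mathcomp Require Import all_classical all_reals all_analysis.
From mathcomp Require Import complex.

Set Implicit Arguments.
Unset Strict Implicit.
Unset Printing Implicit Defensive.

Import Order.TTheory GRing.Theory Num.Theory.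

Local Open Scope classical_set_scope.
Local Open Scope ring_scope.

(* A non-archimedean local field: complete for a normalized discrete valuation,
   with finite residue field.  The value of [lf_val] at 0 is irrelevant: [vge]
   treats 0 as having infinite valuation.  The residue field is given as
   the target of a reduction map, which is only meaningful on the integers. *)
Definition vge (k : zmodType) (v : k -> int) (n : int) (x : k) : Prop :=
  x = 0 \/ n <= v x.

Record localField := LocalField {
  lf_sort :> fieldType;
  lf_resfield : finFieldType;
  lf_val : lf_sort -> int;
  lf_res : lf_sort -> lf_resfield;
  lf_valM : forall x y : lf_sort, x != 0 -> y != 0 ->
    lf_val (x * y) = lf_val x + lf_val y;
  lf_valD : forall n (x y : lf_sort), vge lf_val n x -> vge lf_val n y ->
    vge lf_val n (x + y);
  lf_val_normalized : exists2 x : lf_sort, x != 0 & lf_val x = 1;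
  lf_complete : forall u : nat -> lf_sort,
    (forall n, exists N, forall i j, (N <= i)%N -> (N <= j)%N ->
       vge lf_val n (u i - u j)) ->
    exists x, forall n, exists N, forall i, (N <= i)%N -> vge lf_val n (u i - x);
  lf_res1 : lf_res 1 = 1;
  lf_resD : forall x y, vge lf_val 0 x -> vge lf_val 0 y ->
    lf_res (x + y) = lf_res x + lf_res y;
  lf_resM : forall x y, vge lf_val 0 x -> vge lf_val 0 y ->
    lf_res (x * y) = lf_res x * lf_res y;
  lf_res_surj : forall a, exists2 x, vge lf_val 0 x & lf_res x = a;
  lf_res_ker : forall x, vge lf_val 0 x -> lf_res x = 0 <-> vge lf_val 1 x
}.

Definition lf_vge (k : localField) : int -> k -> Prop := vge (@lf_val k).
Arguments lf_vge : clear implicits.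

Definition integers (k : localField) : set k := [set x | lf_vge k 0 x].
Arguments integers : clear implicits.

Definition uniformizer (k : localField) (varpi : k) : Prop :=
  varpi != 0 /\ lf_val varpi = 1.

Definition frac_ideal (k : localField) (varpi : k) (n : int) : set k :=
  [set varpi ^ n * x | x in integers k].

(* The topology of a finite dimensional k-space: the product topology of the
   coordinates in a basis. *)
Definition valued_space (k : localField) (W : vectType k) : Type := W.

Section ValuedSpace.
Variables (k : localField) (W : vectType k).

Definition vs_ball (n : int) (u : W) : set W :=
  [set w | forall i, lf_vge k n (coord (vbasis {:W}) i (w - u))].

Definition vs_open (U : set W) : Prop :=
  forall u, U u -> exists n, vs_ball n u `<=` U.

Lemma vge_le (n m : int) (x : k) : m <= n -> lf_vge k n x -> lf_vge k m x.
Proof. by move=> mn [->|nx]; [left | right; apply: le_trans nx]. Qed.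

Lemma vs_openT : vs_open setT.
Proof. by move=> u _; exists 0. Qed.

Lemma vs_openI : setI_closed vs_open.
Proof.
move=> A B oA oB u [/oA[n nA] /oB[m mB]].
exists (Num.max n m) => w wu; split.
- by apply: nA => i; apply: vge_le (wu i); rewrite le_max lexx.
- by apply: mB => i; apply: vge_le (wu i); rewrite le_max lexx orbT.
Qed.

Lemma vs_open_bigU (I : Type) (f : I -> set W) :
  (forall i, vs_open (f i)) -> vs_open (\bigcup_i f i).
Proof.
move=> of_ u [i _ /of_[n nf]]; exists n => w /nf fw; by exists i.
Qed.

HB.instance Definition _ := Vector.on (valued_space W).
HB.instance Definition _ :=
  isOpenTopological.Build (valued_space W) vs_openT vs_openI vs_open_bigU.

End ValuedSpace.

Section Symplectic.
Variables (F : fieldType) (V : vectType F).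

Definition symplectic_form (beta : {biscalar V}) : Prop :=
  (forall v, beta v v = 0) /\
  (forall v, (forall w, beta v w = 0) -> v = 0).

Definition Sp (beta : V -> V -> F) : set 'End(V) :=
  [set g | forall v w, beta (g v) (g w) = beta v w].

Definition lagrangian (beta : V -> V -> F) (x : {vspace V}) : Prop :=
  forall v, v \in x <-> (forall a, a \in x -> beta a v = 0).

(* Determinant of the restriction of p to a p-stable subspace x. *)
Definition det_restr (x : {vspace V}) (p : 'End(V)) : F :=
  \det (\matrix_(i, j < \dim x) coord (vbasis x) j (p (tnth (vbasis x) i))).

Record symplectic_basis (beta : V -> V -> F) (l : nat) (e f : 'I_l -> V) : Prop := {
  sb_basis : basis_of {:V} (map e (enum 'I_l) ++ map f (enum 'I_l));
  sb_ee : forall i j, beta (e i) (e j) = 0;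
  sb_ff : forall i j, beta (f i) (f j) = 0;
  sb_ef : forall i j, beta (e i) (f j) = (i == j)%:R }.

Definition is_tau (l : nat) (e f : 'I_l -> V) (S : {set 'I_l}) (t : 'End(V)) : Prop :=
  forall i, t (e i) = (if i \in S then f i else e i) /\
            t (f i) = (if i \in S then - e i else f i).

Definition Siegel_parabolic (beta : V -> V -> F) (x : {vspace V}) : set 'End(V) :=
  [set p | Sp beta p /\ (p @: x)%VS = x].

(* The square class of a nonzero element is represented by that element. *)
Definition same_square_class (a b : F) : Prop := exists2 c, c != 0 & a = b * c ^+ 2.

Record is_theta (beta : V -> V -> F) (x : {vspace V}) (l : nat) (e f : 'I_l -> V)
    (theta : 'End(V) -> F) : Prop := {
  theta_neq0 : forall g, Sp beta g -> theta g != 0;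
  theta_bimul : forall p1 g p2,
    Siegel_parabolic beta x p1 -> Sp beta g -> Siegel_parabolic beta x p2 ->
    same_square_class (theta (p1 \o g \o p2)%VF) (theta p1 * theta g * theta p2);
  theta_det : forall p, Siegel_parabolic beta x p ->
    same_square_class (theta p) (det_restr x p);
  theta_tau : forall S t, is_tau e f S t -> same_square_class (theta t) 1 }.

End Symplectic.

Section Lattices.
Variables (k : localField) (varpi : k) (W : vectType k) (beta : {biscalar W}).
Variable (lam : int).

Record lattice (B : set W) : Prop := {
  lattice0 : B 0;
  latticeD : forall v w, B v -> B w -> B (v + w);
  latticeZ : forall a v, integers k a -> B v -> B (a *: v);
  lattice_open : open (B : set (valued_space W));
  lattice_compact : compact (B : set (valued_space W)) }.

Definition dual_lattice (B : set W) : set W :=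
  [set v | forall b, B b -> frac_ideal varpi lam (beta v b)].

Definition good_lattice (B : set W) : Prop :=
  [/\ lattice B, [set varpi *: v | v in dual_lattice B] `<=` B &
      B `<=` dual_lattice B].

Definition lattice_stabilizer (B : set W) : set 'End(W) :=
  [set g | Sp beta g /\ g @` B = B].

End Lattices.

(* A residue-field vector space together with a reduction map identifying it
   with the quotient Bs / B (the map is only meaningful on Bs). *)
Record quotient_space (k : localField) (W : vectType k) (Bs B : set W) :=
  QuotientSpace {
  qs_sort :> vectType (lf_resfield k);
  qs_pr : W -> qs_sort;
  qs_prD : forall v w, Bs v -> Bs w -> qs_pr (v + w) = qs_pr v + qs_pr w;
  qs_prZ : forall a v, integers k a -> Bs v -> qs_pr (a *: v) = lf_res a *: qs_pr v;
  qs_surj : forall u, exists2 v, Bs v & qs_pr v = u;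
  qs_ker : forall v, Bs v -> qs_pr v = 0 <-> B v
}.

Section Residual.
Variables (R : realType) (k : localField) (varpi : k) (W : vectType k).
Variables (beta : {biscalar W}) (psi : k -> R[i]) (lam : int) (B : set W).
Variable V : quotient_space (dual_lattice varpi beta lam B) B.

Definition res_lift (a : lf_resfield k) : k :=
  xget 0 [set x | integers k x /\ lf_res x = a].

Definition qs_lift (u : V) : W :=
  xget 0 [set v | dual_lattice varpi beta lam B v /\ qs_pr V v = u].

Definition unitary_character : Prop :=
  (forall x y, psi (x + y) = psi x * psi y) /\ (forall x, `|psi x| = 1).

Definition conductor : Prop :=
  (forall x, frac_ideal varpi lam x -> psi x = 1) /\
  (exists2 x, frac_ideal varpi (lam - 1) x & psi x <> 1).

(* The three residual objects are defined through arbitrary lifts; see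
   [res_charE], [res_formE] and [res_mapE] for their characterizations. *)
Definition res_char (a : lf_resfield k) : R[i] :=
  psi (varpi ^ (lam - 1) * res_lift a).

Definition res_form (u v : V) : lf_resfield k :=
  lf_res (varpi ^ (1 - lam) * beta (qs_lift u) (qs_lift v)).

Definition res_map (g : 'End(W)) : 'End(V) :=
  linfun (fun u : V => qs_pr V (g (qs_lift u))).

Lemma lf_val1 : @lf_val k 1 = 0.
Proof.
have := lf_valM (oner_neq0 k) (oner_neq0 k); rewrite mulr1 => /eqP.
by rewrite -subr_eq0 opprD addNKr oppr_eq0 => /eqP.
Qed.

Lemma vgeB n (x y : k) : lf_vge k n x -> lf_vge k n y -> lf_vge k n (x - y).
Proof.
move=> hx hy; apply: lf_valD => //.
have vN1 : @lf_val k (-1) = 0.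
  have N1 : (-1 : k) != 0 by rewrite oppr_eq0 oner_neq0.
  have := lf_valM N1 N1; rewrite mulrNN mulr1 lf_val1 => /esym/eqP.
  by rewrite -mulr2n mulrn_eq0 => /eqP.
case: hy => [->|ny]; first by left; rewrite oppr0.
have [->|y0] := eqVneq y 0; first by left; rewrite oppr0.
by right; rewrite -mulN1r lf_valM ?oppr_eq0 ?oner_neq0 // vN1 add0r.
Qed.

Lemma vge_frac_ideal n (x : k) : uniformizer varpi ->
  frac_ideal varpi n x <-> lf_vge k n x.
Proof.
move=> [p0 vp].
have vX (m : nat) : lf_val (varpi ^+ m) = m%:Z.
  elim: m => [|m IH]; first by rewrite expr0 lf_val1.
  by rewrite exprS lf_valM ?expf_neq0 // IH vp -PoszD add1n.
have vXz (m : int) : lf_val (varpi ^ m) = m.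
  case: m => m; first exact: vX.
  rewrite NegzE; have := lf_valM (expfz_neq0 (- m.+1%:Z) p0) (expfz_neq0 m.+1 p0).
  rewrite -expfzDr // addNr expr0z lf_val1.
  rewrite [X in _ + X](vX m.+1) => /esym/eqP.
  by rewrite addr_eq0 => /eqP.
split=> [[y [->|vy] <-]|].
- by left; rewrite mulr0.
- have [->|y0] := eqVneq y 0; first by left; rewrite mulr0.
  by right; rewrite lf_valM ?expfz_neq0 // vXz lerDl.
move=> hx; exists (varpi ^ (- n) * x); last first.
  by rewrite mulrA -expfzDr // subrr expr0z mul1r.
case: hx => [->|nx]; first by left; rewrite mulr0.
have [->|x0] := eqVneq x 0; first by left; rewrite mulr0.
by right; rewrite lf_valM ?expfz_neq0 // vXz addrC subr_ge0.
Qed.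

Lemma lf_resB (x y : k) : integers k x -> integers k y ->
  lf_res (x - y) = lf_res x - lf_res y.
Proof.
move=> hx hy; apply: (addIr (lf_res y)); rewrite subrK -lf_resD ?subrK //.
exact: vgeB.
Qed.

Lemma res_liftP (a : lf_resfield k) :
  integers k (res_lift a) /\ lf_res (res_lift a) = a.
Proof.
have [x ix rx] := lf_res_surj a.
rewrite /res_lift; case: xgetP => [y -> //|/(_ x) []]; by split.
Qed.

Lemma qs_liftP (u : V) :
  dual_lattice varpi beta lam B (qs_lift u) /\ qs_pr V (qs_lift u) = u.
Proof.
have [v bv pv] := qs_surj u.
rewrite /qs_lift; case: xgetP => [y -> //|/(_ v) []]; by split.
Qed.

Lemma res_charE (x : k) : uniformizer varpi -> unitary_character -> conductor ->
  integers k x -> res_char (lf_res x) = psi (varpi ^ (lam - 1) * x).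
Proof.
move=> hp [psiD _] [psi1 _] ix; have [p0 _] := hp.
have [iy ry] := res_liftP (lf_res x); rewrite /res_char.
set y := res_lift _ in iy ry *.
have : lf_vge k 1 (y - x).
  by apply/lf_res_ker; [exact: vgeB | rewrite lf_resB // ry subrr].
case/(vge_frac_ideal _ _ hp) => z iz; rewrite expr1z => yx.
rewrite -[y](subrK x) -yx mulrDr psiD mulrA -{2}(expr1z varpi) -expfzDr // subrK.
by rewrite psi1 ?mul1r //; exists z.
Qed.

Lemma dual_latticeD v w : uniformizer varpi ->
  dual_lattice varpi beta lam B v -> dual_lattice varpi beta lam B w ->
  dual_lattice varpi beta lam B (v + w).
Proof.
move=> hp hv hw b Bb; apply/(vge_frac_ideal _ _ hp); rewrite linearDl /=.
by apply: lf_valD; apply/(vge_frac_ideal _ _ hp); [apply: hv | apply: hw].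
Qed.

Lemma dual_latticeZ a v : uniformizer varpi ->
  integers k a -> dual_lattice varpi beta lam B v ->
  dual_lattice varpi beta lam B (a *: v).
Proof.
move=> hp ia hv b Bb; rewrite linearZl_LR /=.
have [y iy <-] := hv b Bb; exists (a * y); last by rewrite mulrCA.
case: ia => [->|va]; first by left; rewrite mul0r.
case: iy => [->|vy]; first by left; rewrite mulr0.
have [->|a0] := eqVneq a 0; first by left; rewrite mul0r.
have [->|y0] := eqVneq y 0; first by left; rewrite mulr0.
by right; rewrite lf_valM // addr_ge0.
Qed.

Lemma integers1 : integers k 1.
Proof. by right; rewrite lf_val1. Qed.

Lemma dual_latticeB v w : uniformizer varpi ->
  dual_lattice varpi beta lam B v -> dual_lattice varpi beta lam B w ->
  dual_lattice varpi beta lam B (v - w).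
Proof.
move=> hp hv hw; rewrite -scaleN1r; apply: dual_latticeD => //.
apply: dual_latticeZ => //; rewrite -sub0r.
by apply: vgeB; [left | exact: integers1].
Qed.

Lemma qs_prB v w : uniformizer varpi ->
  dual_lattice varpi beta lam B v -> dual_lattice varpi beta lam B w ->
  qs_pr V (v - w) = qs_pr V v - qs_pr V w.
Proof.
move=> hp hv hw; apply: (addIr (qs_pr V w)); rewrite subrK -qs_prD ?subrK //.
exact: dual_latticeB.
Qed.

Lemma qs_lift_pr v : uniformizer varpi ->
  dual_lattice varpi beta lam B v -> B (qs_lift (qs_pr V v) - v).
Proof.
move=> hp hv; have [h1 h2] := qs_liftP (qs_pr V v).
by apply/(qs_ker V); [exact: dual_latticeB | rewrite qs_prB // h2 subrr].
Qed.

Lemma beta_asym v w : symplectic_form beta -> beta v w = - beta w v.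
Proof.
move=> [alt _]; apply/eqP; rewrite -addr_eq0.
have := alt (v + w).
by rewrite linearDl /= !linearDr /= !alt addr0 add0r => ->.
Qed.

Lemma beta_dual v w : uniformizer varpi -> good_lattice varpi beta lam B ->
  dual_lattice varpi beta lam B v -> dual_lattice varpi beta lam B w ->
  integers k (varpi ^ (1 - lam) * beta v w).
Proof.
move=> hp [_ pB _] hv hw; have [p0 _] := hp.
have [y iy] := hv (varpi *: w) (pB _ (imageP _ hw)).
rewrite linearZr_LR /= => e.
by rewrite expfzDr // expr1z mulrAC -e mulrAC -expfzDr // subrr expr0z mul1r.
Qed.

Lemma res_formE v w : uniformizer varpi -> symplectic_form beta ->
  good_lattice varpi beta lam B ->
  dual_lattice varpi beta lam B v -> dual_lattice varpi beta lam B w ->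
  res_form (qs_pr V v) (qs_pr V w) = lf_res (varpi ^ (1 - lam) * beta v w).
Proof.
move=> hp hs hB hv hw; have [p0 _] := hp; have [_ _ BBs] := hB.
have [v1 _] := qs_liftP (qs_pr V v); have [w1 _] := qs_liftP (qs_pr V w).
have bv := qs_lift_pr hp hv; have bw := qs_lift_pr hp hw.
rewrite /res_form; set v' := qs_lift _ in v1 bv *; set w' := qs_lift _ in w1 bw *.
apply/eqP; rewrite -subr_eq0 -lf_resB; try exact: beta_dual.
apply/eqP/lf_res_ker; first by apply: vgeB; exact: beta_dual.
have -> : varpi ^ (1 - lam) * beta v' w' - varpi ^ (1 - lam) * beta v w =
   varpi ^ (1 - lam) * (beta v' (w' - w) - beta w (v' - v)).
  rewrite -mulrBr; congr (_ * _); rewrite !linearBr /= (beta_asym w v') //.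
  by rewrite (beta_asym w v) // opprB opprK [X in _ = _ + X]addrC addrA subrK.
rewrite mulrBr; apply: vgeB.
- have [y iy <-] := v1 _ bw; apply/(vge_frac_ideal _ _ hp).
  by exists y => //; rewrite mulrA -(expfzDr (1 - lam) lam p0) subrK.
- have [y iy <-] := hw _ bv; apply/(vge_frac_ideal _ _ hp).
  by exists y => //; rewrite mulrA -(expfzDr (1 - lam) lam p0) subrK.
Qed.

Lemma stab_dual g v : lattice_stabilizer beta B g ->
  dual_lattice varpi beta lam B v -> dual_lattice varpi beta lam B (g v).
Proof.
by move=> [gS gB] hv b; rewrite -gB => -[c Bc <-]; rewrite gS; exact: hv.
Qed.

Lemma res_mapE g v : uniformizer varpi -> good_lattice varpi beta lam B ->
  lattice_stabilizer beta B g -> dual_lattice varpi beta lam B v ->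
  res_map g (qs_pr V v) = qs_pr V (g v).
Proof.
move=> hp hB gK hv; have [_ gB] := gK; have [_ _ BBs] := hB.
have key u w : dual_lattice varpi beta lam B w -> qs_pr V w = u ->
    qs_pr V (g (qs_lift u)) = qs_pr V (g w).
  move=> hw <-; have [h1 h2] := qs_liftP (qs_pr V w).
  apply/eqP; rewrite -subr_eq0 -qs_prB //; try exact: stab_dual.
  rewrite -linearB /=; apply/eqP/(qs_ker V).
    by apply: stab_dual => //; exact: dual_latticeB.
  have gBs b : B b -> B (g b) by move=> Bb; rewrite -gB; exists b.
  by apply: gBs; exact: qs_lift_pr.
have lin : linear (fun u : V => qs_pr V (g (qs_lift u))).
  move=> a u1 u2; have [h1 e1] := qs_liftP u1; have [h2 e2] := qs_liftP u2.
  have [ia ea] := res_liftP a.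
  have iz := dual_latticeZ hp ia h1.
  rewrite (key _ (res_lift a *: qs_lift u1 + qs_lift u2)).
  - have s1 := stab_dual gK h1; have s2 := stab_dual gK h2.
    have s3 := dual_latticeZ hp ia s1.
    by rewrite linearP /= qs_prD // qs_prZ // ea.
  - exact: dual_latticeD.
  - by rewrite qs_prD // qs_prZ // ea e1 e2.
pose L := GRing.isLinear.Build _ _ _ _ _ lin.
pose Lf : {linear V -> V} := HB.pack (fun u : V => qs_pr V (g (qs_lift u))) L.
by rewrite /res_map -[LHS]/(linfun Lf (qs_pr V v)) lfunE /=; exact: key.
Qed.

End Residual.

Arguments res_form {k varpi W beta lam B} V u v.

Section Models.
Variables (R : realType) (k : localField) (varpi : k) (W : vectType k).
Variables (beta : {biscalar W}) (psi : k -> R[i]) (lam : int) (B : set W).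
Variable V : quotient_space (dual_lattice varpi beta lam B) B.
Variable x : {vspace V}.

Local Notation C := R[i].
Local Notation F := (lf_resfield k).
Local Notation Bs := (dual_lattice varpi beta lam B).
Local Notation psib := (res_char varpi psi lam).
Local Notation betab := (res_form V).
Local Notation q := (#|F|).

(* The space of the Schroedinger-type model attached to the Lagrangian x. *)
Definition finite_model (f : V -> C) : Prop :=
  forall a w, a \in x -> f (a + w) = psib (2^-1 * betab w a) * f w.

Definition finite_rho (w : V) (t : F) (f : V -> C) : V -> C :=
  fun w' => psib (t + 2^-1 * betab w' w) * f (w' + w).

Definition finite_sqnorm (f : V -> C) : R :=
  \sum_(v : finvect_type V) (complex.Re (f v) ^+ 2 + complex.Im (f v) ^+ 2).

Definition sqrt_q : C := (Num.sqrt (q%:R : R))%:C%C.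

Definition omega (a : F) : C := sqrt_q^-1 * \sum_(t : F) psib (2^-1 * a * t ^+ 2).

Definition half_dim : nat := (\dim {:V})./2.

Definition jrank (g : 'End(V)) : nat := (half_dim - \dim (x :&: g @: x)%VS)%N.

Definition finite_Weil (theta : 'End(V) -> F) (g : 'End(V)) (f : V -> C) : V -> C :=
  fun w =>
    (omega (theta g))^-1 * omega 1 ^ (1 - (jrank g)%:Z)
    * sqrt_q ^+ jrank g * (q%:R ^+ half_dim)^-1
    * \sum_(a : finvect_type V | (a : V) \in x)
        psib (2^-1 * betab a w) * f ((g^-1)%VF (w + a)).

Definition rho_tilde (b : W) (t : k) (f : V -> C) : V -> C :=
  fun v => psi t * finite_rho (qs_pr V b) 0 f v.

(* Bs is open, so W / Bs is discrete and the integral over W / Bs is, up to a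
   positive constant, a sum over cosets.  The summand does not depend on the
   representative chosen in each coset when phi is in [gen_lattice_model]. *)
Definition dual_cosets : set (set W) := range (fun w => [set b + w | b in Bs]).

Definition gen_sqnorm (phi : W -> V -> C) : \bar R :=
  \esum_(c in dual_cosets) (finite_sqnorm (phi (xget 0 c)))%:E.

Record gen_lattice_model (phi : W -> V -> C) : Prop := {
  glm_values : forall w, finite_model (phi w);
  glm_equivariant : forall b w, Bs b ->
    phi (b + w) = (fun v => psi (2^-1 * beta w b) * rho_tilde b 0 (phi w) v);
  glm_sqint : (gen_sqnorm phi < +oo)%E }.

Definition glm_space : Type := {phi : W -> V -> C | gen_lattice_model phi}.

Definition glm_fun (phi : glm_space) : W -> V -> C := proj1_sig phi.
Coercion glm_fun : glm_space >-> Funclass.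

Definition gen_rho (w : W) (t : k) (phi : W -> V -> C) : W -> V -> C :=
  fun w' v => psi (t + 2^-1 * beta w' w) * phi (w' + w) v.

Definition gen_Weil (theta : 'End(V) -> F) (g : 'End(W)) (phi : W -> V -> C) :
    W -> V -> C :=
  fun w => finite_Weil theta (res_map V g) (phi ((g^-1)%VF w)).

(* Surjective linear isometries.  Linear combinations in [glm_space] are
   expressed pointwise. *)
Record unitary_op (U : glm_space -> glm_space) : Prop := {
  unitary_linear : forall (a : C) (phi1 phi2 phi : glm_space),
    (forall w v, phi w v = a * phi1 w v + phi2 w v) ->
    forall w v, U phi w v = a * U phi1 w v + U phi2 w v;
  unitary_isometry : forall phi : glm_space, gen_sqnorm (U phi) = gen_sqnorm phi;
  unitary_bij : bijective U }.

(* U rho(w, t) U^-1 = rho(g w, t): phi' is the element rho(w, t) phi of the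
   (rho-stable) space [glm_space]. *)
Definition intertwines (g : 'End(W)) (U : glm_space -> glm_space) : Prop :=
  forall (w : W) (t : k) (phi phi' : glm_space),
    glm_fun phi' = gen_rho w t phi -> glm_fun (U phi') = gen_rho (g w) t (U phi).

Definition Sp_hat : set ('End(W) * (glm_space -> glm_space)) :=
  [set gU | [/\ Sp beta gU.1, unitary_op gU.2 & intertwines gU.1 gU.2]].

(* The subgroups of [Sp_hat] that surject onto Sp(W) with kernel of order 2;
   Mp(W) is the only one. *)
Record is_metaplectic (M : set ('End(W) * (glm_space -> glm_space))) : Prop := {
  mp_sub : M `<=` Sp_hat;
  mp_one : M (\1%VF, id);
  mp_mul : forall g U g' U', M (g, U) -> M (g', U') -> M ((g \o g')%VF, U \o U');
  mp_inv : forall g U U', M (g, U) -> cancel U U' -> cancel U' U -> M ((g^-1)%VF, U');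
  mp_surj : forall g, Sp beta g -> exists U, M (g, U);
  mp_ker : ([set U | M (\1%VF, U)] #= `I_2)%card }.

End Models.

(* Main.v *)
Require Import Defs.
From HB Require Import structures.
From mathcomp Require Import all_boot all_order all_algebra all_field.
From mathcomp Require Import all_classical all_reals all_analysis.
From mathcomp Require Import complex.
From mathcomp Require Import ring.

Set Implicit Arguments.
Unset Strict Implicit.
Unset Printing Implicit Defensive.

Import Order.TTheory GRing.Theory Num.Theory.

Local Open Scope classical_set_scope.
Local Open Scope ring_scope.

(** Restricting a function in the generalized lattice model to the coordinate
    [v = 0] identifies the model with the lattice model of the self-dual lattice
    [A = {v in B* | v mod B in x}].  Let [delta_0] be its vector supported on [A].
    A lift [U] of [g] in [K_B] is determined by [vac_coef U = (U delta_0)(0)], and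
    up to a sign [gen_Weil g] is the lift with [vac_coef = omega(1)^-j q^(-j/2)],
    [j = l - dim (x cap g x)].  Since -1 lies in Mp, only the square of [vac_coef]
    has to be computed, for lifts in Mp; there the dependence on theta disappears.

    On the stabilizer of [A] it is a character, to be shown trivial.  This
    stabilizer is generated by transvections [u_t] along [e] in [A].  If [D]
    dilates a hyperbolic plane [(e, f)] by [(varpi, 1/varpi)], then [delta_0] and
    its image under a lift of [D] are not orthogonal, so [u_t] acts by the same
    scalar on both: the character agrees at [u_t] and [u_(varpi^2 t)], and
    [varpi^2 - 1] is a unit.

    In general, if [g] does not stabilize [A], two transvections turn [g] into an
    element with a smaller [j], and comparing with a conjugate of a transvection
    stabilizing [A] shows that the square of [vac_coef] gets multiplied by the
    square of a quadratic Gauss sum. *)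

(** * Quadratic Gauss sums *)

Section GaussSums.
Variables (R : realType) (F : finFieldType) (chi : F -> R[i]).
Hypothesis two_neq0 : 2 != 0 :> F.
Hypothesis chiD : forall a b, chi (a + b) = chi a * chi b.
Hypothesis chi_norm : forall a, `|chi a| = 1.
Hypothesis chi_neq1 : exists a, chi a != 1.

Lemma char_neq0 a : chi a != 0.
Proof. by rewrite -normr_eq0 chi_norm oner_eq0. Qed.

Lemma char0 : chi 0 = 1.
Proof. by apply: (mulfI (char_neq0 0)); rewrite -chiD addr0 mulr1. Qed.

Lemma char_conj a : (chi a)^*%C = chi (- a).
Proof.
apply: (mulfI (char_neq0 a)).
by rewrite -chiD subrr char0 -sqr_normc chi_norm expr1n.
Qed.

Lemma char_sum0 (a : F) : a != 0 -> \sum_t chi (a * t) = 0.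
Proof.
move=> a0; have [b hb] := chi_neq1.
have E : \sum_t chi (a * t) = \sum_t chi t.
  have inj : injective (fun t => a * t) by exact: mulfI.
  by rewrite [RHS](reindex_inj inj).
rewrite E; apply/eqP; have : chi b * (\sum_t chi t) = \sum_t chi t.
  rewrite [RHS](reindex_inj (addrI b)) mulr_sumr.
  by apply: eq_bigr => t _; rewrite chiD.
move/eqP; rewrite -subr_eq0 -{2}[\sum_t _]mul1r -mulrBl mulf_eq0 subr_eq0.
by rewrite (negbTE hb).
Qed.

(** Normalized so that [omega a] is [gauss a] divided by the square root of [q]. *)
Definition gauss (a : F) : R[i] := \sum_t chi (2^-1 * a * t ^+ 2).

Lemma gauss_conj a : (gauss a)^*%C = gauss (- a).
Proof.
rewrite /gauss rmorph_sum /=; apply: eq_bigr => t _.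
by rewrite char_conj; congr chi; ring.
Qed.

(** Replacing one summation variable by [s + t] makes the exponent affine in [t] with slope [a * s];
    the sum over [t] vanishes unless [s = 0]. *)
Lemma gauss_norm (a : F) : a != 0 -> gauss a * (gauss a)^*%C = #|F|%:R.
Proof.
move=> a0; rewrite gauss_conj /gauss.
have h2 : (2^-1 : F) != 0 by rewrite invr_eq0.
transitivity (\sum_s \sum_t chi (2^-1 * a * (s ^+ 2)) * chi (a * s * t)).
  rewrite exchange_big mulrC mulr_suml /=.
  under eq_bigr do rewrite mulr_sumr.
  transitivity (\sum_t \sum_s chi (2^-1 * a * (s ^+ 2) + a * s * t)).
    apply: eq_bigr => t _; rewrite (reindex_inj (addIr t)) /=.
    by apply: eq_bigr => s _; rewrite -chiD; congr chi; field.
  by apply: eq_bigr => t _; apply: eq_bigr => s _; rewrite chiD.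
rewrite (bigD1 0) //= [X in _ + X]big1 ?addr0.
  rewrite (eq_bigr (fun=> 1)); last first.
    by move=> t _; rewrite expr2 !mulr0 mul0r char0 mulr1.
  by rewrite sumr_const cardT -cardE.
by move=> s s0; rewrite -mulr_sumr char_sum0 ?mulr0 // mulf_neq0.
Qed.

Lemma gauss_sqr (a c : F) : c != 0 -> gauss (a * c ^+ 2) = gauss a.
Proof.
move=> c0; have inj : injective (fun t => c * t) by exact: mulfI.
rewrite /gauss [RHS](reindex_inj inj) /=.
by apply: eq_bigr => t _; congr chi; ring.
Qed.

Let sqrt_count (c : F) : nat := #|[pred t : F | t ^+ 2 == c]|.

Lemma sqrt_count_le2 c : (sqrt_count c <= 2)%N.
Proof.
rewrite /sqrt_count; case: (pickP [pred t : F | t ^+ 2 == c]) => [s /= /eqP sc|].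
  apply: leq_trans (_ : #|pred2 s (- s)| <= _)%N; last first.
    by rewrite card2; case: (_ == _).
  by apply/subset_leq_card/fintype.subsetP => t; rewrite !inE -sc eqf_sqr.
by move=> h; rewrite eq_card0.
Qed.

(* Each c has at most two preimages among the t^2 and the a t^2 together;
   the totals agree, so it has exactly two. *)
Lemma sqrt_count_nonsquare (a : F) : a != 0 -> (forall c, a != c ^+ 2) ->
  forall c, (sqrt_count c + sqrt_count (c / a))%N = 2%N.
Proof.
move=> a0 nsq.
have le2 c : (sqrt_count c + sqrt_count (c / a) <= 2)%N.
  have [->|c0] := eqVneq c 0.
    rewrite mul0r; have -> : sqrt_count 0 = 1%N.
      rewrite -(card1 (0 : F)); apply: eq_card => t.
      by rewrite !inE expf_eq0.
    by [].
  case: (pickP [pred t : F | t ^+ 2 == c]) => [s /= /eqP sc|h]; last first.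
    by rewrite {1}/sqrt_count eq_card0 //= sqrt_count_le2.
  rewrite addnC {1}/sqrt_count eq_card0 ?sqrt_count_le2 // => t.
  rewrite !inE; apply/negP => /eqP e.
  have t0 : t != 0.
    by apply: contraNneq c0 => t0; move: e; rewrite t0 expr0n /= => /esym/eqP;
       rewrite mulf_eq0 invr_eq0 (negbTE a0) orbF.
  have /eqP := nsq (s / t); apply; rewrite expr_div_n sc e.
  by rewrite invf_div mulrC divfK.
have tot : (\sum_c sqrt_count c = #|F|)%N.
  rewrite -sum1_card [RHS](partition_big (fun t : F => t ^+ 2) predT) //=.
  by apply: eq_bigr => c _; rewrite /sqrt_count -sum1_card; apply: eq_bigl => t;
    rewrite !inE.
have tot2 : (\sum_c sqrt_count (c / a) = #|F|)%N.
  rewrite -tot [RHS](reindex_inj (h := fun c => c / a)) //.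
  by apply: mulIf; rewrite invr_eq0.
move=> c; apply/eqP; rewrite eqn_leq le2 /= leqNgt; apply/negP => lt.
have : (\sum_c (sqrt_count c + sqrt_count (c / a)) < \sum_(c : F) 2)%N.
  rewrite (bigD1 c) // [X in (_ < X)%N](bigD1 c) //= -addSn.
  by apply: leq_add => //; apply: leq_sum.
by rewrite big_split /= tot tot2 sum_nat_const addnn muln2 ltnn.
Qed.

(** If [a] is a square, rescaling the summation variable removes it. Otherwise the values [t ^ 2]
    and [a * t ^ 2] together cover each element twice, so [gauss a + gauss 1] is twice a full
    character sum, hence zero. *)
Lemma gauss_sign (a : F) : a != 0 -> gauss a = gauss 1 \/ gauss a = - gauss 1.
Proof.
move=> a0; have [[c hc]|nsq] := pselect (exists c, a = c ^+ 2).
  left; rewrite hc -[_ ^+ 2]mul1r gauss_sqr //.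
  by apply: contra_neq a0 => c0; rewrite hc c0 expr0n.
right; apply/eqP; rewrite -addr_eq0.
have cnt (f : F -> R[i]) : \sum_t f (t ^+ 2) = \sum_c f c *+ sqrt_count c.
  rewrite (partition_big (fun t : F => t ^+ 2) predT) //=.
  apply: eq_bigr => c _; rewrite (eq_bigr (fun=> f c)) ?sumr_const //.
  by move=> t /eqP ->.
rewrite /gauss (cnt (fun t => chi (2^-1 * a * t))) (cnt (fun t => chi (2^-1 * 1 * t))).
rewrite (reindex_inj (h := fun c => c / a)) /=; last first.
  by apply: mulIf; rewrite invr_eq0.
rewrite -big_split /= (eq_bigr (fun t => chi (2^-1 * t) *+ 2)); last first.
  move=> c _; rewrite mulr1 -mulrA (mulrC a) divfK // -mulrnDr addnC.
  by rewrite sqrt_count_nonsquare // => d; apply: contra_notN nsq => /eqP ->; exists d.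
by rewrite sumrMnl char_sum0 ?mul0rn // invr_eq0.
Qed.

End GaussSums.

(** * Local fields *)

Section LocalFieldBasics.
Variable (k : localField).
Implicit Types (x y : k) (n m : int).

Lemma vgeD n x y : lf_vge k n x -> lf_vge k n y -> lf_vge k n (x + y).
Proof. exact: lf_valD. Qed.

Lemma vgeN n x : lf_vge k n x -> lf_vge k n (- x).
Proof. by move=> h; rewrite -sub0r; apply: vgeB => //; left. Qed.

Lemma vgeM n m x y : lf_vge k n x -> lf_vge k m y -> lf_vge k (n + m) (x * y).
Proof.
case=> [->|nx]; first by left; rewrite mul0r.
case=> [->|my]; first by left; rewrite mulr0.
have [->|x0] := eqVneq x 0; first by left; rewrite mul0r.
have [->|y0] := eqVneq y 0; first by left; rewrite mulr0.
by right; rewrite lf_valM // lerD.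
Qed.

Lemma vgeM0 n x y : lf_vge k 0 x -> lf_vge k n y -> lf_vge k n (x * y).
Proof. by move=> hx hy; rewrite -[n]add0r; apply: vgeM. Qed.

Lemma vge1 : lf_vge k 0 1.
Proof. by right; rewrite lf_val1. Qed.

Lemma lf_valV x : x != 0 -> lf_val x^-1 = - lf_val x.
Proof.
move=> x0; have := @lf_valM k x x^-1 x0; rewrite invr_eq0 => /(_ x0).
by rewrite divff // lf_val1 => /esym/eqP; rewrite addrC addr_eq0 => /eqP.
Qed.

Definition vunit x := x != 0 /\ lf_val x = 0.

Lemma vunitP x : lf_vge k 0 x -> ~ lf_vge k 1 x -> vunit x.
Proof.
move=> [->|h0] h1; first by case: h1; left.
split; first by apply/eqP => e; apply: h1; left.
apply/eqP; rewrite eq_le h0 andbT leNgt; apply/negP => h; apply: h1.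
by right; rewrite -gtz0_ge1.
Qed.

Lemma vunit_vge0 x : vunit x -> lf_vge k 0 x.
Proof. by move=> [x0 v]; right; rewrite v. Qed.

Lemma vunit_vge1 x : vunit x -> ~ lf_vge k 1 x.
Proof. by move=> [x0 v] [e|]; [rewrite e eqxx in x0 | rewrite v]. Qed.

Lemma vunitV x : vunit x -> vunit x^-1.
Proof. by move=> [x0 v]; split; [rewrite invr_eq0 | rewrite lf_valV // v oppr0]. Qed.

Lemma vunitN x : vunit x -> vunit (- x).
Proof.
move=> ux; apply: vunitP; first exact/vgeN/vunit_vge0.
by move/vgeN; rewrite opprK; exact: vunit_vge1.
Qed.

Lemma vunit1 : vunit 1.
Proof. by split; [exact: oner_neq0 | exact: lf_val1]. Qed.

Lemma vunitD x y : vunit x -> lf_vge k 1 y -> vunit (x + y).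
Proof.
move=> ux hy; apply: vunitP.
  by apply: vgeD; [exact: vunit_vge0 | apply: vge_le hy].
by move=> h; apply: (vunit_vge1 ux); rewrite -[x](addrK y); apply: vgeB.
Qed.

Lemma lf_res0 : lf_res (0 : k) = 0.
Proof. by apply/lf_res_ker; left. Qed.

Lemma lf_resN x : lf_vge k 0 x -> lf_res (- x) = - lf_res x.
Proof. by move=> h; rewrite -sub0r lf_resB ?lf_res0 ?sub0r //; left. Qed.

Hypothesis res_char_neq2 : 2%N \notin [pchar lf_resfield k].

Lemma two_res_neq0 : 2 != 0 :> lf_resfield k.
Proof. by move: res_char_neq2; rewrite inE /= => ->. Qed.

Lemma lf_res2 : lf_res (2 : k) = 2.
Proof. by rewrite -[2 : k]/(1 + 1) lf_resD ?lf_res1 //; exact: vge1. Qed.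

Lemma vunit2 : vunit (2 : k).
Proof.
apply: vunitP; first by rewrite -[2 : k]/(1 + 1); apply: vgeD; exact: vge1.
move=> h; have h0 : lf_vge k 0 (2 : k) by apply: vge_le h.
by have := (lf_res_ker h0).2 h; rewrite lf_res2 => /eqP; rewrite (negbTE two_res_neq0).
Qed.

Lemma vge_half : lf_vge k 0 (2^-1).
Proof. exact/vunit_vge0/vunitV/vunit2. Qed.

Lemma lf_res_half : lf_res (2^-1 : k) = 2^-1.
Proof.
have h2 := vunit_vge0 vunit2.
apply: (mulfI two_res_neq0); rewrite -{1}lf_res2 -lf_resM //; last exact: vge_half.
by rewrite (divff two_res_neq0) divff ?lf_res1 //; case: vunit2.
Qed.

End LocalFieldBasics.

Section UniformizerPowers.
Variables (k : localField) (varpi : k).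
Hypothesis varpi_unif : uniformizer varpi.

Lemma varpi_neq0 : varpi != 0.
Proof. by case: varpi_unif. Qed.

Lemma val_varpiX (n : int) : lf_val (varpi ^ n) = n.
Proof.
have h : frac_ideal varpi n (varpi ^ n).
  by exists 1; [exact: vge1 | rewrite mulr1].
have h' : frac_ideal varpi (- n) (varpi ^ (- n)).
  by exists 1; [exact: vge1 | rewrite mulr1].
have e0 m : varpi ^ m != 0 by rewrite expfz_neq0 // varpi_neq0.
move: h h' => /(vge_frac_ideal _ _ varpi_unif) [/eqP|h]; first by rewrite (negbTE (e0 _)).
move=> /(vge_frac_ideal _ _ varpi_unif) [/eqP|]; first by rewrite (negbTE (e0 _)).
by rewrite -invr_expz lf_valV // lerN2 => h'; apply/eqP; rewrite eq_le h h'.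
Qed.

Lemma vge_varpiX (n : int) : lf_vge k n (varpi ^ n).
Proof. by right; rewrite val_varpiX. Qed.

Lemma vge_varpiM (n m : int) (y : k) :
  lf_vge k m (varpi ^ n * y) <-> lf_vge k (m - n) y.
Proof.
split=> h; last by rewrite -(subrKC n m); apply: vgeM h; exact: vge_varpiX.
have -> : y = varpi ^ (- n) * (varpi ^ n * y).
  by rewrite mulrA -expfzDr ?varpi_neq0 // addNr expr0z mul1r.
by rewrite addrC; apply: vgeM h; exact: vge_varpiX.
Qed.

End UniformizerPowers.

(** Evaluates an endomorphism defined by a bare formula, such as [transv] or [dilation], once the
    formula is shown to be linear. *)
Lemma linfunE (F : fieldType) (V1 V2 : vectType F) (h : V1 -> V2) :
  linear h -> linfun h =1 h.
Proof.
move=> lin v; pose L := GRing.isLinear.Build _ _ _ _ _ lin.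
pose Lf : {linear V1 -> V2} := HB.pack h L.
by rewrite -[linfun h]/(linfun Lf) lfunE.
Qed.

(** * Symplectic groups and transvections *)

Section SymplecticGroup.
Variables (F : fieldType) (V : vectType F) (beta : {biscalar V}).
Hypothesis beta_symp : symplectic_form beta.
Implicit Types (g h : 'End(V)).

Lemma Sp_ker0 g : Sp beta g -> lker g == 0%VS.
Proof.
move=> gS; apply/lker0P => v w e; apply/eqP; rewrite -subr_eq0; apply/eqP.
by apply: beta_symp.2 => z; rewrite -gS linearB /= e subrr linear0l.
Qed.

Lemma Sp_one : Sp beta \1%VF.
Proof. by move=> v w; rewrite !lfunE. Qed.

Lemma Sp_comp g h : Sp beta g -> Sp beta h -> Sp beta (g \o h)%VF.
Proof. by move=> gS hS v w; rewrite !comp_lfunE gS hS. Qed.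

Lemma Sp_invK g : Sp beta g -> cancel (g^-1)%VF g.
Proof. by move=> gS w; apply: lker0_lfunVK; exact: Sp_ker0. Qed.

Lemma Sp_Kinv g : Sp beta g -> cancel g (g^-1)%VF.
Proof. by move=> gS w; apply: lker0_lfunK; exact: Sp_ker0. Qed.

Lemma Sp_inv g : Sp beta g -> Sp beta (g^-1)%VF.
Proof. by move=> gS v w; rewrite -gS !Sp_invK. Qed.

End SymplecticGroup.

(* The form is rescaled by [varpi ^ (- lam)], so that duality refers to the integers. *)
Definition nform (k : localField) (varpi : k) (W : vectType k) (beta : {biscalar W})
  (lam : int) (v w : W) : k := varpi ^ (- lam) * beta v w.

Section Transvections.
Variables (k : localField) (varpi : k) (W : vectType k) (beta : {biscalar W}) (lam : int).
Hypothesis varpi_unif : uniformizer varpi.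
Hypothesis beta_symp : symplectic_form beta.
Local Notation nb := (nform varpi beta lam).
Implicit Types (v w e : W) (t : k) (g : 'End(W)).

Lemma beta_nform v w : beta v w = varpi ^ lam * nb v w.
Proof.
by rewrite /nform mulrA -expfzDr ?varpi_neq0 // subrr expr0z mul1r.
Qed.

Lemma nformDl v v' w : nb (v + v') w = nb v w + nb v' w.
Proof. by rewrite /nform linearDl mulrDr. Qed.
Lemma nformDr v w w' : nb v (w + w') = nb v w + nb v w'.
Proof. by rewrite /nform linearDr mulrDr. Qed.
Lemma nformZl a v w : nb (a *: v) w = a * nb v w.
Proof. by rewrite /nform linearZl_LR mulrCA. Qed.
Lemma nformZr a v w : nb v (a *: w) = a * nb v w.
Proof. by rewrite /nform linearZr_LR mulrCA. Qed.
Lemma nformNl v w : nb (- v) w = - nb v w.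
Proof. by rewrite -scaleN1r nformZl mulN1r. Qed.
Lemma nformNr v w : nb v (- w) = - nb v w.
Proof. by rewrite -scaleN1r nformZr mulN1r. Qed.
Lemma nform0l w : nb 0 w = 0.
Proof. by rewrite -(scale0r (0 : W)) nformZl mul0r. Qed.
Lemma nform0r w : nb w 0 = 0.
Proof. by rewrite -(scale0r (0 : W)) nformZr mul0r. Qed.
Lemma nformC v w : nb v w = - nb w v.
Proof. by rewrite /nform (beta_asym _ _ beta_symp) mulrN. Qed.
Lemma nformvv v : nb v v = 0.
Proof. by rewrite /nform (beta_symp.1 v) mulr0. Qed.
Definition nformE := (nformDl, nformDr, nformNl, nformNr, nformZl, nformZr).

Lemma nform_nondeg v : (forall w, nb v w = 0) -> v = 0.
Proof. by move=> h; apply: beta_symp.2 => w; rewrite beta_nform h mulr0. Qed.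

Lemma Sp_nform g : Sp beta g <-> (forall v w, nb (g v) (g w) = nb v w).
Proof.
by split=> h v w; [rewrite /nform h | rewrite !beta_nform h].
Qed.

Definition transv e t : 'End(W) := linfun (fun w => w + (t * nb w e) *: e).

Lemma transvE e t w : transv e t w = w + (t * nb w e) *: e.
Proof.
rewrite /transv linfunE // => a u v; rewrite !nformE mulrDr mulrCA scalerDl.
by rewrite scalerDr scalerA addrACA.
Qed.

Lemma transv_Sp e t : Sp beta (transv e t).
Proof.
apply/Sp_nform => v w; rewrite !transvE !nformE nformvv (nformC e w).
ring.
Qed.

Lemma transvD e s t : transv e (s + t) = (transv e s \o transv e t)%VF.
Proof.
apply/lfunP => w; rewrite comp_lfunE !transvE !nformE nformvv !mulr0 addr0.
by rewrite -addrA -scalerDl -mulrDl (addrC s).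
Qed.

Lemma transv0 e : transv e 0 = \1%VF.
Proof. by apply/lfunP => w; rewrite transvE mul0r scale0r addr0 lfunE. Qed.

Lemma transvV e t : ((transv e t)^-1)%VF = transv e (- t).
Proof.
have h : (transv e t \o transv e (- t) = \1)%VF by rewrite -transvD subrr transv0.
rewrite -[RHS]comp_lfun1l -(lker0_compVf (Sp_ker0 beta_symp (transv_Sp e t)))
  -comp_lfunA h.
by rewrite comp_lfun1r.
Qed.

Lemma transvZ a e t : transv (a *: e) t = transv e (a ^+ 2 * t).
Proof.
by apply/lfunP => w; rewrite !transvE nformZr scalerA; congr (_ + _ *: _); ring.
Qed.

Lemma transv_conj g e t : Sp beta g ->
  (g \o transv e t = transv (g e) t \o g)%VF.
Proof.
move=> /Sp_nform gS; apply/lfunP => w.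
by rewrite !comp_lfunE !transvE linearD linearZ /= gS.
Qed.

(** The coefficient of [v - w] in the displacement of [v] is [nb v (v - w) / nb v w = -1]. *)
Lemma transv_move v w : nb v w != 0 -> transv (v - w) (nb v w)^-1 v = w.
Proof.
move=> h; rewrite transvE !nformE nformvv sub0r mulrN mulVf // scaleN1r.
by rewrite opprB addrC subrK.
Qed.

End Transvections.

(** * Self-dual lattices and hyperbolic pairs *)

Section SelfDual.
Variables (k : localField) (varpi : k) (W : vectType k) (beta : {biscalar W}) (lam : int).
Hypothesis varpi_unif : uniformizer varpi.
Hypothesis beta_symp : symplectic_form beta.
Local Notation nb := (nform varpi beta lam).
Local Notation transv := (transv varpi beta lam).
Variable A : set W.
Hypothesis A_selfdual : forall v, A v <-> (forall a, A a -> lf_vge k 0 (nb v a)).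
Hypothesis A_absorb : forall w, exists n : nat, A (varpi ^+ n *: w).

Lemma selfdual_nform v w : A v -> A w -> lf_vge k 0 (nb v w).
Proof. by move=> /A_selfdual; apply. Qed.

Lemma selfdualD v w : A v -> A w -> A (v + w).
Proof.
move=> hv hw; apply/A_selfdual => a ha; rewrite nformDl.
by apply: vgeD; apply: selfdual_nform.
Qed.

Lemma selfdualZ c v : lf_vge k 0 c -> A v -> A (c *: v).
Proof.
move=> hc hv; apply/A_selfdual => a ha; rewrite nformZl.
by apply: vgeM0 => //; apply: selfdual_nform.
Qed.

Lemma selfdualN v : A v -> A (- v).
Proof. by move=> hv; rewrite -scaleN1r; apply/selfdualZ/hv/vgeN/vge1. Qed.

Lemma selfdualB v w : A v -> A w -> A (v - w).
Proof. by move=> hv hw; apply/selfdualD/selfdualN. Qed.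

Lemma selfdual0 : A 0.
Proof. by apply/A_selfdual => a _; rewrite nform0l; left. Qed.

(** Only the inclusion of [g A] in [A] is required; the reverse one follows from self-duality in
    [stabA_inv]. *)
Definition stabA (g : 'End(W)) : Prop := Sp beta g /\ (forall a, A a -> A (g a)).

Lemma stabA_inv g : stabA g -> stabA (g^-1)%VF.
Proof.
move=> [gS gA]; split; first exact: (Sp_inv beta_symp gS).
move=> a ha; apply/A_selfdual => c hc.
have := (Sp_nform beta lam varpi_unif g).1 gS => <-.
rewrite (Sp_invK beta_symp gS).
by apply: selfdual_nform => //; apply: gA.
Qed.

Lemma stabA_comp g h : stabA g -> stabA h -> stabA (g \o h)%VF.
Proof.
move=> [gS gA] [hS hA]; split; first exact: Sp_comp.
by move=> a ha; rewrite comp_lfunE; apply/gA/hA.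
Qed.

Lemma stabA_transv e t : A e -> lf_vge k 0 t -> stabA (transv e t).
Proof.
move=> he ht; split; first exact: transv_Sp.
move=> a ha; rewrite transvE; apply: selfdualD => //; apply: selfdualZ => //.
by apply: vgeM0 => //; apply: selfdual_nform.
Qed.

(** [e] is the multiple of [w] by the smallest power of [varpi] that lands in [A]. Since [e / varpi]
    is outside [A], self-duality gives [a] in [A] with [nb e a] a unit, and [f] is [a] rescaled. *)
Lemma primitive_pair (w : W) : w != 0 ->
  exists e f (n : int), [/\ A e, A f, nb e f = 1, w = varpi ^ n *: e &
                            A w -> 0 <= n].
Proof.
move=> w0; have [m hm] := A_absorb w.
have [n hn hn'] : exists2 n : nat, A (varpi ^ (m%:Z - n%:Z) *: w) &
    ~ A (varpi ^ (m%:Z - n.+1%:Z) *: w).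
  apply: contrapT => /forall2NP h.
  have all n : A (varpi ^ (m%:Z - n%:Z) *: w).
    elim: n => [|n IH]; first by rewrite subr0.
    by have [//|] := h n => /contrapT.
  move/eqP: w0; apply.
  apply: (nform_nondeg (lam := lam) varpi_unif beta_symp) => w'.
  have [m' hm'] := A_absorb w'.
  apply: contrapT => /eqP d0.
  (* For this [n] the pairing of [varpi ^ (m - n) w] with [varpi ^ m' w'] has valuation at most -1,
     although both vectors lie in [A]. *)
  pose n := absz (m%:Z + m'%:Z + lf_val (nb w w') + 1).
  have := selfdual_nform (all n) hm'.
  have p0 := varpi_neq0 varpi_unif.
  have q0 : varpi ^+ m' * nb w w' != 0 by apply: mulf_neq0 => //; exact: expf_neq0.
  have q1 := expfz_neq0 (m%:Z - n%:Z) p0.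
  rewrite nformZl nformZr => -[/eqP|].
    by rewrite mulf_eq0 (negbTE q0) (negbTE q1).
  rewrite (lf_valM q1 q0) lf_valM //; last exact: expf_neq0.
  rewrite val_varpiX // -[varpi ^+ m']/(varpi ^ (m'%:Z)) val_varpiX // /n.
  rewrite abszE.
  set z := (_ + _ + 1)%R; have := ler_norm z; rewrite {1}/z => h1 h2.
  have : m%:Z + m'%:Z + lf_val (nb w w') + 1 <= m%:Z + m'%:Z + lf_val (nb w w').
    apply: le_trans h1 _; rewrite -subr_ge0; apply: le_trans h2 _.
    by rewrite le_eqVlt; apply/orP; left; apply/eqP; ring.
  by rewrite gerDl.
set e := varpi ^ (m%:Z - n%:Z) *: w in hn.
have we : w = varpi ^ (n%:Z - m%:Z) *: e.
  by rewrite scalerA -expfzDr ?varpi_neq0 // addrA subrK subrr expr0z scale1r.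
have ne : ~ A (varpi ^ (-1) *: e).
  apply: contra_not hn'; rewrite scalerA -expfzDr ?varpi_neq0 //.
  by congr (A (_ ^ _ *: _)); rewrite -addn1 PoszD; ring.
have [a ha uc] : exists2 a, A a & vunit (nb e a).
  apply: contrapT => /forall2NP h; apply: ne; apply/A_selfdual => a ha.
  rewrite nformZl; apply/vge_varpiM => //; rewrite sub0r opprK.
  have [//|/(_ (vunitP _ _)) nu] := h a.
  by apply: contrapT => n1; apply: nu => //; exact: selfdual_nform.
exists e, ((nb e a)^-1 *: a), (n%:Z - m%:Z); split => //.
- by apply: selfdualZ => //; exact/vunit_vge0/vunitV.
- by rewrite nformZr mulVf //; case: uc.
move=> Aw; rewrite leNgt; apply/negP => lt0; apply: ne.
have -> : varpi ^ (-1) *: e = varpi ^ (-1 - (n%:Z - m%:Z)) *: w.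
  by rewrite {1}/e scalerA -expfzDr ?varpi_neq0 //; congr (_ ^ _ *: _); ring.
apply: selfdualZ => //; right; rewrite val_varpiX //.
by rewrite lerBrDr add0r -subr_ge0; move: lt0; rewrite -lezD1 -subr_ge0;
  congr (0 <= _); ring.
Qed.

End SelfDual.

(** * Generation of the stabilizer of a self-dual lattice *)

Section Generation.
Variables (k : localField) (varpi : k) (W : vectType k) (beta : {biscalar W}) (lam : int).
Hypothesis varpi_unif : uniformizer varpi.
Hypothesis beta_symp : symplectic_form beta.
Local Notation nb := (nform varpi beta lam).
Local Notation transv := (transv varpi beta lam).
Variable A : set W.
Hypothesis A_selfdual : forall v, A v <-> (forall a, A a -> lf_vge k 0 (nb v a)).
Hypothesis A_absorb : forall w, exists n : nat, A (varpi ^+ n *: w).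
Local Notation stabA := (stabA beta A).

Variable P : 'End(W) -> Prop.
Hypothesis P_one : P \1%VF.
Hypothesis P_transv : forall e t g, A e -> lf_vge k 0 t -> stabA g ->
  P (transv e t \o g)%VF -> P g.

(** The image of [pi] splits off orthogonally from [A]; in the induction it is the subspace on which
    [g] is already trivial. *)
Record orthoproj (pi : 'End(W)) : Prop := {
  orthoproj_idem : forall w, pi (pi w) = pi w;
  orthoproj_adj : forall v w, nb (pi v) w = nb v (pi w);
  orthoproj_A : forall a, A a -> A (pi a) }.

Section Step.
Variable pi : 'End(W).
Hypothesis pi_proj : orthoproj pi.

Definition fixes_proj (g : 'End(W)) := stabA g /\ (forall w, g (pi w) = pi w).

Definition Aker (v : W) := A v /\ pi v = 0.

Lemma AkerB v w : Aker v -> Aker w -> Aker (v - w).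
Proof.
move=> [Av v0] [Aw w0]; split; first exact: (selfdualB A_selfdual).
by rewrite linearB /= v0 w0 subrr.
Qed.

Lemma AkerD v w : Aker v -> Aker w -> Aker (v + w).
Proof.
move=> [Av v0] [Aw w0]; split; first exact: (selfdualD A_selfdual).
by rewrite linearD /= v0 w0 addr0.
Qed.

Lemma fixes_proj_ker g v : fixes_proj g -> Aker v -> Aker (g v).
Proof.
move=> [[gS gA] gpi] [Av v0]; split; first exact: gA.
apply: (nform_nondeg (lam := lam) varpi_unif beta_symp) => w.
rewrite (orthoproj_adj pi_proj) -(gpi w) (Sp_nform beta lam varpi_unif g).1 //.
by rewrite -(orthoproj_adj pi_proj) v0 nform0l.
Qed.

(** The transvection is integral because [nb v w] is a unit, and it fixes the image of [pi] because
    [v - w] lies in the kernel, orthogonal to that image. Used with [v = g u], so that [h u = w]. *)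
Lemma P_move g v w : fixes_proj g -> Aker v -> Aker w -> vunit (nb v w) ->
  let h := (transv (v - w) (nb v w)^-1 \o g)%VF in
  fixes_proj h /\ (P h -> P g).
Proof.
move=> [gK gpi] hv hw hu h; have [Az z0] := AkerB hv hw.
have hu' := vunit_vge0 (vunitV hu).
split; last by apply: P_transv.
split; first by apply: (stabA_comp _ gK); exact: (stabA_transv varpi_unif beta_symp).
move=> u; rewrite comp_lfunE gpi transvE (orthoproj_adj pi_proj) z0 nform0r mulr0.
by rewrite scale0r addr0.
Qed.

(** One transvection carries [g e] to [e] if they pair to a unit; otherwise two do, through a vector
    pairing to units with both. *)
Lemma P_fix_first e f g : Aker e -> Aker f -> nb e f = 1 ->
  (forall h, fixes_proj h -> h e = e -> P h) -> fixes_proj g -> P g.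
Proof.
move=> he hf ef IH hg.
have move1 h : fixes_proj h -> vunit (nb (h e) e) -> P h.
  move=> hh hu; have [h' Ph] := P_move hh (fixes_proj_ker hh he) he hu.
  apply: Ph; apply: IH => //; rewrite comp_lfunE.
  by apply: transv_move; case: hu.
have gS : nb (g e) (g f) = 1.
  by rewrite (Sp_nform beta lam varpi_unif g).1 //; case: hg => [[]].
have hge := fixes_proj_ker hg he; have hgf := fixes_proj_ker hg hf.
(* Take [f] or [g f] if it works; if both fail, the failing pairings are divisible by [varpi], and
   those of [f + g f] are 1 and -1 up to such terms. *)
have [w hw [u1 u2]] : exists2 w, Aker w & vunit (nb (g e) w) /\ vunit (nb w e).
  have i1 : lf_vge k 0 (nb (g e) f).
    by apply: (selfdual_nform A_selfdual); [case: hge | case: hf].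
  have i2 : lf_vge k 0 (nb (g f) e).
    by apply: (selfdual_nform A_selfdual); [case: hgf | case: he].
  have fe : nb f e = -1 by rewrite (nformC _ _ beta_symp) ef.
  have u1 : vunit (1 : k) by exact: vunit1.
  have uN1 : vunit (-1 : k) by exact/vunitN.
  have [h1|h1] := pselect (lf_vge k 1 (nb (g e) f)); last first.
    by exists f => //; split; [exact: vunitP | rewrite fe].
  have [h2|h2] := pselect (lf_vge k 1 (nb (g f) e)); last first.
    by exists (g f) => //; split; [rewrite gS | exact: vunitP].
  exists (f + g f); first exact: AkerD.
  by rewrite !nformE gS fe; split; [rewrite addrC|]; apply: vunitD.
have [h' Ph] := P_move hg hge hw u1; apply: Ph; apply: move1 => //.
by rewrite comp_lfunE transv_move //; case: u1.
Qed.

(** The vector [e] stays fixed: [g f] and [f] pair equally with [e], so [g f - f] is orthogonal to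
    [e]. *)
Lemma P_fix_second e f g : Aker e -> Aker f -> nb e f = 1 ->
  (forall h, fixes_proj h -> h e = e -> h f = f -> P h) ->
  fixes_proj g -> g e = e -> P g.
Proof.
move=> he hf ef IH hg ge.
have move1 h : fixes_proj h -> h e = e -> vunit (nb (h f) f) -> P h.
  move=> hh hhe hu; have hhf := fixes_proj_ker hh hf.
  have [h' Ph] := P_move hh hhf hf hu.
  apply: Ph; apply: IH => //; rewrite comp_lfunE; last first.
    by apply: transv_move => //; case: hu.
  have eh : nb e (h f) = 1.
    by rewrite -{1}hhe (Sp_nform beta lam varpi_unif h).1 //; case: hh => [[]].
  by rewrite hhe transvE !nformE ef eh subrr mulr0 scale0r addr0.
have hgf := fixes_proj_ker hg hf.
have eg : nb e (g f) = 1.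
  by rewrite -{1}ge (Sp_nform beta lam varpi_unif g).1 //; case: hg => [[]].
have fe : nb f e = -1 by rewrite (nformC _ _ beta_symp) ef.
have ge1 : nb (g f) e = -1 by rewrite (nformC _ _ beta_symp) eg.
have i1 : lf_vge k 0 (nb (g f) f).
  by apply: (selfdual_nform A_selfdual); [case: hgf | case: hf].
have [h1|h1] := pselect (lf_vge k 1 (nb (g f) f)); last exact/move1/vunitP.
(* The intermediate vector [f + e] pairs with [e] as [f] does, with [f] to a unit, and with [g f] to
   -1 modulo [varpi]. *)
have hfe := AkerD hf he.
have u : vunit (nb (g f) (f + e)).
  by rewrite nformDr ge1 addrC; apply: vunitD h1; exact/vunitN/vunit1.
have [h' Ph] := P_move hg hgf hfe u; apply: Ph; apply: move1 => //.
  rewrite comp_lfunE ge transvE !nformE eg ef (nformvv _ _ beta_symp).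
  by rewrite addr0 subrr mulr0 scale0r addr0.
rewrite comp_lfunE transv_move //; last by case: u.
by rewrite nformDl (nformvv _ _ beta_symp) add0r ef; exact: vunit1.
Qed.

(** Adds to [pi] the orthogonal projection onto the hyperbolic plane of [e] and [f]. *)
Definition planeproj e f : 'End(W) :=
  linfun (fun w => pi w + (nb w f *: e - nb w e *: f)).

Lemma planeprojE e f w : planeproj e f w = pi w + (nb w f *: e - nb w e *: f).
Proof.
rewrite /planeproj linfunE // => a u v; rewrite linearP /= !nformE.
rewrite !scalerDl !scalerDr scalerN !scalerA opprD.
by rewrite [X in _ + X = _]addrACA [LHS]addrACA.
Qed.

Lemma planeproj_orthoproj e f : Aker e -> Aker f -> nb e f = 1 ->
  orthoproj (planeproj e f).
Proof.
move=> [Ae e0] [Af f0] ef.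
have fe : nb f e = -1 by rewrite (nformC _ _ beta_symp) ef.
have pe w : nb (pi w) e = 0 by rewrite (orthoproj_adj pi_proj) e0 nform0r.
have pf w : nb (pi w) f = 0 by rewrite (orthoproj_adj pi_proj) f0 nform0r.
split=> [w|v w|a Aa].
- rewrite !planeprojE linearD linearB !linearZ /= e0 f0 (orthoproj_idem pi_proj).
  rewrite oppr0 !scaler0 !addr0 !nformE pe pf ef fe !(nformvv _ _ beta_symp).
  by rewrite !(mulr0, mulr1, mulrN1, oppr0, opprK, addr0, add0r).
- rewrite !planeprojE !nformE (orthoproj_adj pi_proj); congr (_ + _).
  by rewrite (nformC _ _ beta_symp e w) (nformC _ _ beta_symp f w); ring.
- rewrite planeprojE; apply: (selfdualD A_selfdual); first exact: orthoproj_A.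
  by apply: (selfdualB A_selfdual); apply: (selfdualZ A_selfdual) => //;
     exact: (selfdual_nform A_selfdual).
Qed.

Lemma planeproj_ker e f : Aker e -> Aker f -> nb e f = 1 ->
  (\dim (lker (planeproj e f)) < \dim (lker pi))%N.
Proof.
move=> [Ae e0] [Af f0] ef.
have sub : (lker (planeproj e f) <= lker pi)%VS.
  apply/subvP => w; rewrite !memv_ker planeprojE => /eqP h.
  have := congr1 pi h; rewrite linearD linearB !linearZ /= e0 f0.
  by rewrite (orthoproj_idem pi_proj) oppr0 !scaler0 !addr0 linear0 => ->.
rewrite ltn_neqAle dimvS // andbT; apply/negP => /eqP eqd.
have E : lker (planeproj e f) = lker pi by apply/eqP;
  rewrite -(geq_leqif (dimv_leqif_eq sub)) eqd.
have : e \in lker pi by rewrite memv_ker e0.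
rewrite -E memv_ker planeprojE e0 ef (nformvv _ _ beta_symp) scale0r scale1r subr0 add0r.
move=> /eqP e00; move: ef; rewrite e00 nform0l => /esym/eqP.
by rewrite oner_eq0.
Qed.

End Step.

(** Starting from [pi = 0], each round makes [g] fix one more hyperbolic plane. When the kernel of
    [pi] is zero, [pi] is the identity and so is [g]. *)
Lemma transv_generation g : stabA g -> P g.
Proof.
move=> gK; pose pi0 : 'End(W) := 0.
suff gen n pi h : (\dim (lker pi) <= n)%N -> orthoproj pi -> fixes_proj pi h -> P h.
  apply: (@gen (\dim (lker pi0)) pi0) => //.
    split=> [w|v w|a _]; rewrite ?lfunE /= ?nform0l ?nform0r //.
    exact: (selfdual0 A_selfdual).
  by split=> // w; rewrite zero_lfunE linear0.
elim: n pi h => [|n IH] pi h dn pr hh.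
  have h1 : h = \1%VF.
    move: dn; rewrite leqn0 dimv_eq0 => /lker0P pinj.
    have pi1 w : pi w = w by apply: pinj; exact: orthoproj_idem.
    by apply/lfunP => w; rewrite lfunE /= -[w in LHS]pi1 hh.2 pi1.
  by rewrite h1.
have [ker0|] := eqVneq (lker pi) 0%VS.
  by apply: (IH pi) => //; rewrite ker0 dimv0.
rewrite -vpick0; have := memv_pick (lker pi); rewrite memv_ker.
move: (vpick _) => w /eqP piw w0.
have [e [f [m [Ae Af ef we _]]]] :=
  primitive_pair varpi_unif beta_symp A_selfdual A_absorb w0.
have e0 : pi e = 0.
  have : varpi ^ m *: pi e = 0 by rewrite -linearZ /= -we.
  by move=> /eqP;
    rewrite scaler_eq0 (negbTE (expfz_neq0 _ (varpi_neq0 varpi_unif))) => /eqP.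
have he : Aker pi e by [].
(* Subtracting [pi f] brings [f] into the kernel and keeps its pairing with [e], which is orthogonal
   to the image of [pi]. *)
have hf : Aker pi (f - pi f).
  split; last by rewrite linearB /= (orthoproj_idem pr) subrr.
  by apply: (selfdualB A_selfdual) => //; apply: orthoproj_A pr _ Af.
have ef' : nb e (f - pi f) = 1 by rewrite !nformE -(orthoproj_adj pr) e0 nform0l subr0.
apply: (P_fix_first pr he hf ef') hh => h' hh' he'.
apply: (P_fix_second pr he hf ef') hh' he' => h2 hh2 he2 hf2.
apply: (IH (planeproj pi e (f - pi f))).
- by rewrite -ltnS; apply: leq_trans dn; exact: (planeproj_ker pr).
- exact: planeproj_orthoproj.
split; first by case: hh2.
move=> u; rewrite planeprojE linearD (linearB h2) !linearZ /= he2 hf2.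
by case: hh2 => _ ->.
Qed.

End Generation.

Lemma card_vspace_pred (F : finFieldType) (vT : vectType F) (X : {vspace vT}) :
  #|[pred v : finvect_type vT | (v : vT) \in X]| = (#|F| ^ \dim X)%N.
Proof.
case: vT X => T c X.
rewrite -(@card_vspace F (finvect_type (Vector.Pack c)) c X).
by apply: eq_card.
Qed.

(** * The lattice model *)

Section Model.
Variables (R : realType) (k : localField) (varpi : k) (W : vectType k).
Variables (beta : {biscalar W}) (psi : k -> R[i]) (lam : int) (B : set W).
Variable V : quotient_space (dual_lattice varpi beta lam B) B.
Variable x : {vspace V}.
Hypothesis res_char_neq2 : 2%N \notin [pchar lf_resfield k].
Hypothesis varpi_unif : uniformizer varpi.
Hypothesis psi_char : unitary_character psi.
Hypothesis psi_cond : conductor varpi psi lam.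
Hypothesis beta_symp : symplectic_form beta.
Hypothesis B_good : good_lattice varpi beta lam B.
Hypothesis x_lagr : lagrangian (res_form V) x.

Local Notation C := R[i].
Local Notation F := (lf_resfield k).
Local Notation Bs := (dual_lattice varpi beta lam B).
Local Notation psib := (res_char varpi psi lam).
Local Notation betab := (res_form V).
Local Notation nb := (nform varpi beta lam).
Local Notation pr := (qs_pr V).
Local Notation H := (glm_space psi x).

Lemma psiD s t : psi (s + t) = psi s * psi t.
Proof. by case: psi_char. Qed.

Lemma psi_neq0 s : psi s != 0.
Proof. by rewrite -normr_eq0; case: psi_char => _ ->; exact: oner_neq0. Qed.

Lemma psi0 : psi 0 = 1.
Proof. by apply: (mulfI (psi_neq0 0)); rewrite -psiD addr0 mulr1. Qed.

Lemma psi_conj s : (psi s)^*%C = psi (- s).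
Proof.
apply: (mulfI (psi_neq0 s)); rewrite -psiD subrr psi0 -sqr_normc.
by case: psi_char => _ ->; rewrite expr1n.
Qed.

Lemma psi_vge s : lf_vge k lam s -> psi s = 1.
Proof. by move=> /(vge_frac_ideal _ _ varpi_unif); case: psi_cond => h _; exact: h. Qed.

Lemma betaDl u v w : beta (u + v) w = beta u w + beta v w.
Proof. by rewrite linearDl. Qed.
Lemma betaDr u v w : beta w (u + v) = beta w u + beta w v.
Proof. by rewrite linearDr. Qed.
Lemma betaNl v w : beta (- v) w = - beta v w.
Proof. by rewrite linearNl. Qed.
Lemma betaNr v w : beta v (- w) = - beta v w.
Proof. by rewrite linearNr. Qed.
Lemma betaZl a v w : beta (a *: v) w = a * beta v w.
Proof. by rewrite linearZl_LR. Qed.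
Lemma betaZr a v w : beta v (a *: w) = a * beta v w.
Proof. by rewrite linearZr_LR. Qed.
Lemma beta0l w : beta 0 w = 0.
Proof. by rewrite linear0l. Qed.
Lemma beta0r w : beta w 0 = 0.
Proof. by rewrite linear0r. Qed.
Definition betaE := (betaDl, betaDr, betaNl, betaNr, betaZl, betaZr, beta0l, beta0r).

(** * Phases of the Heisenberg action *)

Definition phase (v w : W) : C := psi (2^-1 * beta v w).
Local Notation ph := phase.

Lemma phaseDl u v w : ph (u + v) w = ph u w * ph v w.
Proof. by rewrite /phase betaDl mulrDr psiD. Qed.
Lemma phaseDr u v w : ph w (u + v) = ph w u * ph w v.
Proof. by rewrite /phase betaDr mulrDr psiD. Qed.
Lemma phaseVl v w : ph v w * ph w v = 1.
Proof. by rewrite /phase -psiD (beta_asym v w beta_symp) mulrN addNr psi0. Qed.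
Lemma phaseNl v w : ph (- v) w = ph w v.
Proof. by rewrite /phase betaNl (beta_asym v w beta_symp) opprK. Qed.
Lemma phaseNr v w : ph v (- w) = ph w v.
Proof. by rewrite /phase betaNr (beta_asym v w beta_symp) opprK. Qed.
Lemma phasevv v : ph v v = 1.
Proof. by rewrite /phase (beta_symp.1 v) mulr0 psi0. Qed.
Lemma phase0l v : ph 0 v = 1.
Proof. by rewrite /phase beta0l mulr0 psi0. Qed.
Lemma phase0r v : ph v 0 = 1.
Proof. by rewrite /phase beta0r mulr0 psi0. Qed.
Lemma phase_norm v w : `|ph v w| = 1.
Proof. by case: psi_char => _; exact. Qed.
Lemma phase_conj v w : (ph v w)^*%C = ph w v.
Proof. by rewrite /phase psi_conj -mulrN -(beta_asym w v beta_symp). Qed.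

Lemma dual_vge v : Bs v <-> (forall b, B b -> lf_vge k lam (beta v b)).
Proof. by split=> h b /h /(vge_frac_ideal _ _ varpi_unif). Qed.

Lemma dualD v w : Bs v -> Bs w -> Bs (v + w).
Proof. exact: dual_latticeD. Qed.

Lemma lattice_dual v : B v -> Bs v.
Proof. by case: B_good => _ _ h /h. Qed.

Lemma dual0 : Bs 0.
Proof. by apply/dual_vge => b _; rewrite beta0l; left. Qed.

Lemma pr0 : pr 0 = 0.
Proof.
have := qs_prD V dual0 dual0; rewrite addr0 => /(congr1 (fun y => y - pr 0)).
by rewrite addrK subrr.
Qed.

(** The scalings [varpi ^ (lam - 1)] in the residual character and [varpi ^ (1 - lam)] in the
    residual form cancel. *)
Lemma phase_res v w : Bs v -> Bs w -> psib (2^-1 * betab (pr v) (pr w)) = ph v w.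
Proof.
move=> hv hw; rewrite res_formE // -(lf_res_half res_char_neq2) -lf_resM; last first.
- exact: (beta_dual varpi_unif B_good).
- exact: vge_half.
rewrite res_charE //; last first.
  by apply: vgeM0; [exact: vge_half | exact: (beta_dual varpi_unif B_good)].
have e : varpi ^ (lam - 1) * varpi ^ (1 - lam) = 1.
  by rewrite -expfzDr ?varpi_neq0 // addrA subrK subrr expr0z.
by rewrite /phase; congr (psi _); rewrite -[RHS]mul1r -e; ring.
Qed.

(** * The self-dual lattice above the Lagrangian *)

Definition selfA : set W := [set v | Bs v /\ pr v \in x].
Local Notation A := selfA.

Lemma lattice_selfA v : B v -> A v.
Proof.
move=> Bv; have hv := lattice_dual Bv; split=> //.
by have /(qs_ker V hv) -> := Bv; exact: mem0v.
Qed.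

Lemma res_form_eq0 v w : Bs v -> Bs w ->
  betab (pr v) (pr w) = 0 <-> lf_vge k lam (beta v w).
Proof.
move=> hv hw; rewrite res_formE //.
have hi := beta_dual varpi_unif B_good hv hw.
split=> [/(lf_res_ker hi)|h].
  by move=> /(vge_varpiM varpi_unif); rewrite opprB addrC subrK.
by apply/(lf_res_ker hi)/(vge_varpiM varpi_unif); rewrite opprB addrC subrK.
Qed.

(** Orthogonality to [B], contained in [A], already puts [v] in [Bs]; then its residue is orthogonal
    to the Lagrangian [x], hence in it. *)
Lemma selfA_selfdual v : A v <-> (forall a, A a -> lf_vge k lam (beta v a)).
Proof.
split=> [[hv vx] a [ha ax]|h].
  apply/(res_form_eq0 hv ha); by move/x_lagr: ax; apply.
have hv : Bs v by apply/dual_vge => b /lattice_selfA/h.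
split=> //; apply/x_lagr => a ax.
have [c hc ec] := qs_surj a; rewrite -ec; apply/(res_form_eq0 hc hv).
by rewrite (beta_asym _ _ beta_symp); apply/vgeN/h; split; rewrite ?ec.
Qed.

Lemma selfA_nform v : A v <-> (forall a, A a -> lf_vge k 0 (nb v a)).
Proof.
split=> [/selfA_selfdual h a /h ha|h].
  by apply/(vge_varpiM varpi_unif); rewrite sub0r opprK.
apply/selfA_selfdual => a /h /(vge_varpiM varpi_unif).
by rewrite sub0r opprK.
Qed.

Lemma selfA_beta v w : A v -> A w -> lf_vge k lam (beta v w).
Proof. by move=> /selfA_selfdual; apply. Qed.

Lemma phase_vge v w : lf_vge k lam (beta v w) -> ph v w = 1.
Proof. by move=> h; apply/psi_vge/vgeM0 => //; exact: vge_half. Qed.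

Lemma phaseA v w : A v -> A w -> ph v w = 1.
Proof. by move=> hv hw; apply/phase_vge/selfA_beta. Qed.

Lemma phaseB v w : Bs v -> B w -> ph v w = 1.
Proof. by move=> /dual_vge hv hw; apply/phase_vge/hv. Qed.

(** If the valuation of [s] were below [lam], the integral multiples of [s] would contain the ideal
    [varpi ^ (lam - 1)], where [psi] is not trivial. *)
Lemma psi_vgeP s : (forall c, lf_vge k 0 c -> psi (c * s) = 1) -> lf_vge k lam s.
Proof.
move=> h; apply: contrapT => nv.
have s0 : s != 0 by apply/eqP => e; apply: nv; left.
have lt : lf_val s < lam by rewrite ltNge; apply/negP => e; apply: nv; right.
case: psi_cond => _ [y /(vge_frac_ideal _ _ varpi_unif) hy]; apply.
rewrite -(divfK s0 y); apply: h.
case: hy => [->|hy]; first by left; rewrite mul0r.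
have [->|yn0] := eqVneq y 0; first by left; rewrite mul0r.
right; rewrite lf_valM ?invr_eq0 // lf_valV // subr_ge0.
by apply: le_trans hy; rewrite lerBrDr lezD1.
Qed.

Lemma selfA_psi w : (forall a, A a -> psi (beta w a) = 1) -> A w.
Proof.
move=> h; apply/selfA_selfdual => a ha; apply: psi_vgeP => c hc.
by rewrite -betaZr; apply/h/(selfdualZ selfA_nform).
Qed.

Local Notation AD := (selfdualD selfA_nform).
Local Notation AN := (selfdualN selfA_nform).
Local Notation AB := (selfdualB selfA_nform).
Local Notation A0 := (selfdual0 selfA_nform).
Local Notation AZ := (selfdualZ selfA_nform).

(** * Scalar functions of the lattice model of [A] and their extensions *)

Definition equivariant (Phi : W -> C) : Prop :=
  forall a w, A a -> Phi (a + w) = ph w a * Phi w.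

(** Inverse to taking the coordinate at 0; by [extE] the chosen lift of [v] is immaterial, lifts
    differing by elements of [B]. *)
Definition ext (Phi : W -> C) : W -> V -> C :=
  fun w v => ph (qs_lift v) w * Phi (qs_lift v + w).

Lemma extE Phi b w : equivariant Phi -> Bs b -> ext Phi w (pr b) = ph b w * Phi (b + w).
Proof.
move=> eq_Phi hb; rewrite /ext; set c := qs_lift _.
have Bc : B (c - b) by exact: qs_lift_pr.
have Ac := lattice_selfA Bc.
have -> : c = (c - b) + b by rewrite subrK.
rewrite -(addrA _ b w) (eq_Phi (c - b)) //
  (phaseDl (c - b) b) (phaseDl b w) (phaseB hb Bc) mul1r.
by rewrite -[RHS]mul1r -(phaseVl (c - b) w); ring.
Qed.

(** The conditions of [gen_lattice_model] without square integrability. *)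
Definition alg_model (phi : W -> V -> C) : Prop :=
  (forall w, finite_model psi x (phi w)) /\
  (forall b w, Bs b ->
    phi (b + w) = (fun v => psi (2^-1 * beta w b) * rho_tilde psi b 0 (phi w) v)).

Lemma ext_alg Phi : equivariant Phi -> alg_model (ext Phi).
Proof.
move=> eq_Phi; split=> [w a v ax|b w hb].
  have [c hc ec] := qs_surj a; have [d hd ed] := qs_surj v.
  have Ac : A c by split; rewrite ?ec.
  rewrite -ec -ed -qs_prD // !extE //; last exact: dualD.
  rewrite phase_res // -(addrA c d w) (eq_Phi c) // (phaseDl c d) (phaseDl d w).
  rewrite -[RHS]mulr1 -(phaseVl w c); ring.
apply/funext => v; have [d hd <-] := qs_surj v.
rewrite /rho_tilde /finite_rho -qs_prD // !extE //; last exact: dualD.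
rewrite psi0 add0r mul1r phase_res // -/(ph w b) addrA phaseDl phaseDr.
rewrite -[LHS]mulr1 -(phaseVl w b); ring.
Qed.

(** This is equivariance under [b] read at the coordinate 0, which the finite translation moves to
    [pr b]; so the coordinate at 0 determines all others. *)
Lemma alg_phi phi b w : alg_model phi -> Bs b -> phi w (pr b) = ph b w * phi (b + w) 0.
Proof.
move=> [_ h] hb; have e : psib (2^-1 * betab 0 (pr b)) = 1.
  by rewrite -{1}pr0 phase_res ?phase0l //; exact: dual0.
rewrite (h b w hb) /rho_tilde /finite_rho psi0 !add0r e !mul1r mulrA.
by rewrite -/(ph w b) phaseVl mul1r.
Qed.

Lemma alg_equivariant phi : alg_model phi -> equivariant (fun w => phi w 0).
Proof.
move=> h a w [ha ax].
have : phi w (pr a + 0) = phi w 0.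
  by rewrite (h.1 w (pr a) 0 ax) -[X in psib (_ * betab X _)]pr0 phase_res ?phase0l
    ?mul1r //; exact: dual0.
by rewrite addr0 (alg_phi _ h ha) => <-; rewrite mulrA phaseVl mul1r.
Qed.

Lemma glm_alg (phi : H) : alg_model phi.
Proof. by case: (proj2_sig phi). Qed.

Definition ev (phi : H) : W -> C := fun w => phi w 0.

Lemma ev_equiv (phi : H) : equivariant (ev phi).
Proof. exact/alg_equivariant/glm_alg. Qed.

Lemma ev_phi (phi : H) b w : Bs b -> phi w (pr b) = ph b w * ev phi (b + w).
Proof. by move=> hb; apply: alg_phi => //; exact: glm_alg. Qed.

Lemma ev_inj (phi1 phi2 : H) : ev phi1 =1 ev phi2 -> phi1 = phi2.
Proof.
move=> h; have e : glm_fun phi1 = glm_fun phi2.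
  apply/funext => w; apply/funext => v; have [b hb <-] := qs_surj v.
  by rewrite !ev_phi // h.
case: phi1 phi2 e {h} => [p hp] [p' hp'] /= e; subst p'.
by rewrite (Prop_irrelevance hp hp').
Qed.

(** The equivariant function supported on [w + A] with value 1 at [w]. *)
Definition delta_fun (w w' : W) : C := if `[< A (w' - w) >] then ph w w' else 0.

Lemma delta_funT w w' : A (w' - w) -> delta_fun w w' = ph w w'.
Proof. by move=> h; rewrite /delta_fun asboolT. Qed.

Lemma delta_funF w w' : ~ A (w' - w) -> delta_fun w w' = 0.
Proof. by move=> h; rewrite /delta_fun asboolF. Qed.

Lemma delta_equiv w : equivariant (delta_fun w).
Proof.
move=> a w' Aa; have [h|h] := pselect (A (w' - w)).
  rewrite !delta_funT //; last by rewrite -addrA; exact: AD.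
  rewrite phaseDr; congr (_ * _).
  by rewrite -[w in LHS](subKr w') phaseDl phaseNl (phaseA Aa h) mulr1.
rewrite !delta_funF ?mulr0 //; apply: contra_not h => h.
by rewrite -[w' - w](addKr a); apply: AD; [exact: AN | rewrite addrA].
Qed.

(** * Norms and values at points *)

Definition sqmod (z : C) : R := complex.Re z ^+ 2 + complex.Im z ^+ 2.

Lemma sqmod_phase z u : `|u| = 1 -> sqmod (u * z) = sqmod z.
Proof.
by move=> hu; apply: (@complexI R); rewrite !add_Re2_Im2 normrM hu mul1r.
Qed.

Lemma sqmod_ge0 z : 0 <= sqmod z.
Proof. by rewrite addr_ge0 // sqr_ge0. Qed.

Definition card_x : nat := #|[pred v : finvect_type V | (v : V) \in x]|.

(** Only the [card_x] coordinates [v] with [v + pr b] in [x] change, and there both terms are the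
    values at [w] up to one common phase. *)
Lemma finite_sqnorm_shift phi w b (z : C) : alg_model phi -> Bs b ->
  finite_sqnorm (fun v => z * ext (delta_fun w) (b + w) v + phi (b + w) v) =
  finite_sqnorm (phi (b + w)) + card_x%:R * (sqmod (z + phi w 0) - sqmod (phi w 0)).
Proof.
move=> hphi hb; rewrite /finite_sqnorm.
have key (v : V) : sqmod (z * ext (delta_fun w) (b + w) v + phi (b + w) v) =
    sqmod (phi (b + w) v) + (if v + pr b \in x then sqmod (z + phi w 0) - sqmod (phi
      w 0) else 0).
  have [d hd ed] := qs_surj v; rewrite -ed -qs_prD //.
  rewrite (extE _ (@delta_equiv w) hd) (alg_phi _ hphi hd) addrA.
  have hdb := dualD hd hb.
  case: ifPn => hx.
    have Adb : A (d + b) by split.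
    rewrite delta_funT ?addrK // (alg_equivariant hphi) //
      (phaseDr (d + b) w) phasevv mulr1.
    have -> y : z * (ph d (b + w) * ph w (d + b)) + ph d (b + w) * (ph w (d + b) * y) =
      ph d (b + w) * (ph w (d + b) * (z + y)) by ring.
    by rewrite !(sqmod_phase _ (phase_norm _ _)) subrKC.
  rewrite delta_funF; last by rewrite addrK => -[_]; apply/negP.
  by rewrite !mulr0 add0r addr0.
under eq_bigr do rewrite -/(sqmod _) key.
rewrite big_split /=; congr (_ + _); rewrite -big_mkcond.
have bij : injective (fun v : finvect_type V => (v : V) - pr b : finvect_type V).
  by move=> u v /(congr1 (fun y : V => y + pr b)) /=; rewrite !subrK.
rewrite (reindex_inj bij) (eq_bigl (fun v : finvect_type V => (v : V) \in x)).
  by rewrite sumr_const mulr_natl.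
by move=> v; rewrite /= subrK.
Qed.

(** The added function vanishes outside the coset [w + Bs], so a single term of the sum changes. *)
Lemma gen_sqnorm_shift phi (phi' : W -> V -> C) w (z : C) : alg_model phi ->
  (forall w' v, phi' w' v = z * ext (delta_fun w) w' v + phi w' v) ->
  gen_sqnorm phi' =
  (gen_sqnorm phi + (card_x%:R * (sqmod (z + phi w 0) - sqmod (phi w 0)))%:E)%E.
Proof.
move=> hphi hphi'; pose c0 := [set b + w | b in Bs].
have fge (f : W -> V -> C) (c : set W) : (0 <= (finite_sqnorm (f (xget 0 c)))%:E)%E.
  by rewrite lee_fin sumr_ge0 // => v _; exact: sqmod_ge0.
have c0in : dual_cosets varpi beta lam B c0 by exists w.
rewrite /gen_sqnorm [LHS](esumID [set c0]); last by move=> *; exact: fge.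
rewrite [X in _ = (X + _)%E](esumID [set c0]); last by move=> *; exact: fge.
have -> : dual_cosets varpi beta lam B `&` [set c0] = [set c0].
  by apply/seteqP; split=> [c []|c ->].
rewrite !esum_set1 //.
have [b hb eb] : c0 (xget 0 c0).
  by apply: (@xgetPex _ 0 c0); exists (0 + w); exists 0 => //; exact: dual0.
rewrite -eb [X in finite_sqnorm X](_ : _ =
    (fun v => z * ext (delta_fun w) (b + w) v + phi (b + w) v)); last first.
  by apply/funext => v; exact: hphi'.
rewrite finite_sqnorm_shift // EFinD -!addeA; congr (_ + _)%E.
rewrite [RHS]addeC; congr (_ + _)%E; apply: eq_esum => c [[w1 _ ec] nc].
have [b1 hb1 eb1] : [set b + w1 | b in Bs] (xget 0 c).
  rewrite ec.
  by apply: (@xgetPex _ 0 c); exists (0 + w1); rewrite -ec; exists 0 => //; exact: dual0.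
rewrite -eb1; congr (finite_sqnorm _)%:E; apply/funext => v; rewrite hphi'.
have [d hd ed] := qs_surj v; rewrite -ed (extE _ (@delta_equiv w) hd).
rewrite delta_funF ?mulr0 ?add0r // => -[h _]; apply: nc; rewrite -ec /=.
have hw : Bs (w1 - w).
  have -> : w1 - w =
    (d + (b1 + w1) - w) - (d + b1) by rewrite (addrA d b1) -(addrA (d + b1)) (addrC
      (d + b1)) addrK.
  by apply: dual_latticeB => //; exact: dualD.
apply/seteqP; split=> _ [b2 hb2 <-].
  by exists (b2 + (w1 - w)); [exact: dualD | rewrite -addrA subrK].
exists (b2 - (w1 - w)); first exact: dual_latticeB.
by rewrite opprB addrA subrK.
Qed.

Lemma ext_ev (phi : H) w v : phi w v = ext (ev phi) w v.
Proof.
have [b hb <-] := qs_surj v.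
by rewrite ev_phi // extE //; exact: ev_equiv.
Qed.

Lemma alg_lin (phi1 phi2 : W -> V -> C) (z : C) : alg_model phi1 -> alg_model phi2 ->
  alg_model (fun w v => z * phi1 w v + phi2 w v).
Proof.
move=> [v1 e1] [v2 e2]; split=> [w a v ax|b w hb].
  by rewrite /= (v1 w) // (v2 w) //; ring.
apply/funext => v; rewrite e1 // e2 // /rho_tilde /finite_rho; ring.
Qed.

Lemma ext0 Phi w : equivariant Phi -> ext Phi w 0 = Phi w.
Proof. by move=> h; rewrite -pr0 (extE _ h dual0) phase0l mul1r add0r. Qed.

Lemma gen_sqnorm_ge0 (phi : W -> V -> C) : (0 <= gen_sqnorm phi)%E.
Proof.
by apply: esum_ge0 => c _; rewrite lee_fin sumr_ge0 // => v _; exact: sqmod_ge0.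
Qed.

Lemma gen_sqnorm_fin (phi : H) : gen_sqnorm phi \is a fin_num.
Proof. by rewrite ge0_fin_numE ?gen_sqnorm_ge0 //; case: (proj2_sig phi). Qed.

Definition sqnormH (phi : H) : R := fine (gen_sqnorm phi).

Lemma shift_ex (phi : H) z w :
  exists phi' : H, forall w', ev phi' w' = z * delta_fun w w' + ev phi w'.
Proof.
pose f w' v := z * ext (delta_fun w) w' v + phi w' v.
have hf : alg_model f by apply: alg_lin; [exact/ext_alg/delta_equiv | exact: glm_alg].
have hg : gen_lattice_model psi x f.
  case: (hf) => h1 h2; split=> //.
  rewrite (gen_sqnorm_shift (glm_alg phi) (w := w) (z := z)) //.
  by rewrite -(fineK (gen_sqnorm_fin phi)) -EFinD ltry.
exists (exist _ f hg : H) => w'.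
by rewrite /ev /= /f ext0 //; exact: delta_equiv.
Qed.

(** Evaluation at [w] is, up to [card_x], the inner product with [delta w]; the change of the norm
    under a shift records it without introducing an inner product. *)
Lemma shift_norm (phi phi' : H) z w :
  (forall w', ev phi' w' = z * delta_fun w w' + ev phi w') ->
  sqnormH phi' = sqnormH phi + card_x%:R * (sqmod (z + ev phi w) - sqmod (ev phi w)).
Proof.
move=> h; rewrite /sqnormH (gen_sqnorm_shift (glm_alg phi) (w := w) (z := z)).
  by rewrite fineD ?gen_sqnorm_fin.
move=> w' v; rewrite !ext_ev /ext h; ring.
Qed.

Lemma zero_ex : exists phi : H, forall w, ev phi w = 0.
Proof.
pose f (w : W) (v : V) : C := 0.
have hg : gen_lattice_model psi x f.
  split=> [w a v _|b w _|].
  - by rewrite mulr0.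
  - by apply/funext => v; rewrite /rho_tilde /finite_rho !mulr0.
  rewrite /gen_sqnorm esum1 ?ltry // => c _.
  rewrite /finite_sqnorm big1 // => v _.
  by rewrite /f /= expr0n /= addr0.
by exists (exist _ f hg : H).
Qed.

Definition zeroH : H := projT1 (cid zero_ex).

Lemma ev_zeroH w : ev zeroH w = 0.
Proof. exact: (projT2 (cid zero_ex)). Qed.

Definition delta (w : W) : H := projT1 (cid (shift_ex zeroH 1 w)).

Lemma ev_delta w w' : ev (delta w) w' = delta_fun w w'.
Proof.
by rewrite (projT2 (cid (shift_ex zeroH 1 w))) ev_zeroH mul1r addr0.
Qed.

(** * Finite combinations of delta vectors and adjoints *)

Definition comb (s : seq (C * W)) (w : W) : C := \sum_(i <- s) i.1 * delta_fun i.2 w.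

Lemma comb_ex s (phi : H) :
  exists phi' : H, forall w, ev phi' w = comb s w + ev phi w.
Proof.
elim: s => [|[z u] s [phi' IH]].
  by exists phi => w; rewrite /comb big_nil add0r.
have [phi2 h2] := shift_ex phi' z u; exists phi2 => w.
by rewrite h2 IH /comb big_cons addrA.
Qed.

Lemma sqmodD (z y : C) : sqmod (z + y) - sqmod y = sqmod z + 2 * complex.Re (z^*%C * y).
Proof. by case: z y => [a b] [c d]; rewrite /sqmod /=; ring. Qed.

Lemma ReD (z y : C) : complex.Re (z + y) = complex.Re z + complex.Re y.
Proof. by case: z y => [a b] [c d]. Qed.

Lemma comb_norm s : exists Q : R, forall phi phi' : H,
  (forall w, ev phi' w = comb s w + ev phi w) ->
  sqnormH phi' =
    sqnormH phi + Q + card_x%:R * 2 * complex.Re (\sum_(i <- s) (i.1)^*%C * ev phi i.2).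
Proof.
elim: s => [|[z u] s [Q IH]].
  exists 0 => phi phi' h; have -> : phi' = phi.
    by apply: ev_inj => w; rewrite h /comb big_nil add0r.
  by rewrite big_nil /= mulr0 !addr0.
exists (Q + card_x%:R * (sqmod z + 2 * complex.Re (z^*%C * comb s u))) => phi phi' h.
have [phi1 h1] := comb_ex s phi.
rewrite (@shift_norm phi1 phi' z u); last by move=> w; rewrite h h1 /comb big_cons addrA.
rewrite (IH phi phi1 h1) sqmodD h1 big_cons (mulrDr z^*%C) !ReD /=; ring.
Qed.

(** The consequences of membership in [Sp_hat] used below, transferred to the scalar functions; of
    the Heisenberg group only the elements [(u, 0)] are kept. *)
Record lifts (g : 'End(W)) (U : H -> H) : Prop := {
  lifts_lin : forall a (phi1 phi2 phi : H),
    (forall w, ev phi w = a * ev phi1 w + ev phi2 w) ->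
    forall w, ev (U phi) w = a * ev (U phi1) w + ev (U phi2) w;
  lifts_norm : forall phi, sqnormH (U phi) = sqnormH phi;
  lifts_rho : forall u (phi phi' : H),
    (forall w, ev phi' w = ph w u * ev phi (w + u)) ->
    forall w, ev (U phi') w = ph w (g u) * ev (U phi) (w + g u) }.

Lemma Sp_hat_lifts g U : Sp_hat (g, U) -> lifts g U.
Proof.
move=> [/= gS [Ulin Unorm _] Uint]; split=> [a phi1 phi2 phi h w|phi|u phi phi' h w].
- by apply: (Ulin a phi1 phi2 phi) => w' v; rewrite !ext_ev /ext h; ring.
- by rewrite /sqnormH Unorm.
rewrite /ev (Uint u 0 phi phi') /gen_rho ?add0r //.
apply/funext => w'; apply/funext => v; rewrite add0r -/(ph w' u) !ext_ev /ext h.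
rewrite addrA phaseDl phaseDr; ring.
Qed.

Section Lifts.
Variables (g g' : 'End(W)) (U U' : H -> H).
Hypotheses (hU : lifts g U) (hU' : lifts g' U') (UK : cancel U U').

Lemma lifts_zero w : ev (U zeroH) w = 0.
Proof.
have := lifts_lin hU (a := -1) (phi1 := zeroH) (phi2 := zeroH) (phi := zeroH).
by move=> ->; [rewrite mulN1r addNr | move=> w'; rewrite ev_zeroH mulr0 addr0].
Qed.

(** Adjunction by polarization: the norm of [z * delta w + U th] is compared with that of its image
    under [U'], which is a combination of deltas added to [th]. *)
Lemma lifts_adjoint w s (phi : H) : (forall w', ev (U' (delta w)) w' = comb s w') ->
  ev (U phi) w = \sum_(i <- s) (i.1)^*%C * ev phi i.2.
Proof.
move=> hs.
have nx0 : card_x%:R != 0 :> R.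
  rewrite pnatr_eq0 -lt0n; apply/card_gt0P; exists (0 : V).
  by rewrite inE mem0v.
have key z : complex.Re (z^*%C * ev (U phi) w) =
    complex.Re (z^*%C * \sum_(i <- s) (i.1)^*%C * ev phi i.2).
  pose sz := [seq (z * i.1, i.2) | i <- s].
  have [Q hQ] := comb_norm sz.
  have main (th : H) : sqmod z + 2 * complex.Re (z^*%C * ev (U th) w) =
      Q / card_x%:R + 2 * complex.Re (z^*%C * \sum_(i <- s) (i.1)^*%C * ev th i.2).
    have [p1 h1] := shift_ex (U th) z w.
    have h2 w' : ev (U' p1) w' = comb sz w' + ev th w'.
      rewrite (lifts_lin hU' (a := z) (phi1 := delta w) (phi2 := U th)) ?UK.
        by rewrite hs /comb mulr_sumr /sz big_map; congr (_ + _);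
           apply: eq_bigr => i _; rewrite mulrA.
      by move=> w2; rewrite h1 ev_delta.
    have := hQ th _ h2; rewrite (lifts_norm hU') (shift_norm h1) (lifts_norm hU) sqmodD.
    have -> : \sum_(i <- sz) (i.1)^*%C * ev th i.2 =
        z^*%C * \sum_(i <- s) (i.1)^*%C * ev th i.2.
      rewrite /sz big_map mulr_sumr; apply: eq_bigr => i _ /=.
      by rewrite rmorphM mulrA.
    move=> e; apply: (mulfI nx0);
      rewrite mulrDr [RHS]mulrDr (mulrC card_x%:R (Q / _)) divfK //.
    apply: (addrI (sqnormH th)); rewrite -mulrDr e; ring.
  (* The zero vector determines the constant [Q], which then cancels for [phi]. *)
  have := main zeroH; rewrite lifts_zero mulr0 -[complex.Re 0]/(0 : R) mulr0 addr0.
  rewrite [X in complex.Re (_ * X)]big1 ?mulr0 => [|i _]; last by rewrite ev_zeroH mulr0.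
  rewrite addr0 => e0.
  have := main phi; rewrite e0 => /addrI; apply: mulfI.
  by rewrite pnatr_eq0.
(* These two values of [z] give the real and the imaginary parts. *)
have := key 1; have := key 'i%C.
move: (ev _ _) (\sum_(i <- s) _) => [a b] [c d] /=.
rewrite !mul0r !mul1r ?oppr0 ?mul0r ?mulN1r !opprK ?sub0r ?add0r ?subr0 => -> ->.
by [].
Qed.

End Lifts.

Lemma selfA_absorb w : exists n : nat, A (varpi ^+ n *: w).
Proof.
have [[B0 _ _ Bopen _] _ _] := B_good.
have [n hn] : exists n, vs_ball n 0 `<=` B by exact: Bopen.
(* The sum over all coordinates dominates the exponent needed for each one to enter a ball inside
   [B]. *)
exists (\sum_i absz (n - lf_val (coord (vbasis {:W}) i w)))%N.
apply/lattice_selfA/hn => i; rewrite subr0 linearZ /=.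
set c := coord _ _ _; have [->|c0] := eqVneq c 0; first by left; rewrite mulr0.
have p0 := varpi_neq0 varpi_unif.
right; rewrite lf_valM ?expf_neq0 // exprnP val_varpiX //.
rewrite -lerBlDr; apply: le_trans (ler_norm _) _; rewrite -abszE lez_nat.
by rewrite (bigD1 i) //= leq_addr.
Qed.

Lemma phase_sqr v w : ph v w * ph v w = psi (beta v w).
Proof.
rewrite /phase -psiD -mulrDl; congr (psi _).
have h2 : (2 : k) != 0 by case: (vunit2 res_char_neq2).
have -> : 2^-1 + 2^-1 = 1 :> k by field.
by rewrite mul1r.
Qed.

Lemma rho_delta u w w' :
  ph w' u * delta_fun w (w' + u) = ph w u * delta_fun (w - u) w'.
Proof.
have e : w' + u - w = w' - (w - u) by rewrite opprB addrA.
have [h|h] := pselect (A (w' + u - w)); last first.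
  by rewrite !delta_funF ?mulr0 // -e.
rewrite !delta_funT //; last by rewrite -e.
by rewrite phaseDr phaseDl phaseNl; ring.
Qed.

(** * Vectors fixed by [A] *)

Definition rho_fixes (u : W) (phi : H) : Prop :=
  forall w, ev phi w = ph w u * ev phi (w + u).

Lemma lifts_fixes g U u phi : lifts g U -> rho_fixes u phi -> rho_fixes (g u) (U phi).
Proof. by move=> hU h w; apply: (lifts_rho hU). Qed.

Lemma delta0_fixes a : A a -> rho_fixes a (delta 0).
Proof.
move=> Aa w; rewrite !ev_delta rho_delta sub0r phase0l mul1r.
have [h|h] := pselect (A w); last first.
  rewrite !delta_funF ?subr0 // opprK => h'; apply: h.
  by rewrite -(addrK a w); exact: AB.
rewrite !delta_funT ?subr0 ?opprK //; last exact: AD.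
by rewrite phase0l phaseNl (phaseA h Aa).
Qed.

(* The vector eta is translated by a in two ways, by equivariance and by
   invariance; they are compatible only where psi (beta w a) = 1. *)
Lemma fixes_support (eta : H) w a : A a -> rho_fixes a eta -> ev eta w != 0 ->
  psi (beta w a) = 1.
Proof.
move=> Aa fix_a n0; have := fix_a w.
rewrite [w + a]addrC ev_equiv // mulrA phase_sqr => /(congr1 (fun y => y / ev eta w)).
by rewrite divff // mulfK.
Qed.

(** By [fixes_support] and self-duality such a vector is supported on [A], where equivariance
    determines it by its value at 0. *)
Lemma A_fixes_delta (eta : H) : (forall a, A a -> rho_fixes a eta) ->
  forall w, ev eta w = ev eta 0 * delta_fun 0 w.
Proof.
move=> h w; have [Aw|nA] := pselect (A w).
  by rewrite delta_funT ?subr0 // phase0l mulr1 -{1}[w]addr0 ev_equiv // phase0l mul1r.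
rewrite delta_funF ?subr0 // mulr0; apply/eqP; apply: contrapT => /negP n0; apply: nA.
by apply: selfA_psi => a Aa; exact: (fixes_support Aa (h a Aa)).
Qed.

Local Notation stabA := (stabA beta A).

Definition vac_coef (U : H -> H) : C := ev (U (delta 0)) 0.

Lemma ev_delta00 : ev (delta 0) 0 = 1.
Proof. by rewrite ev_delta delta_funT ?subr0 ?phase0l //; exact: A0. Qed.

(** The image of [delta 0] is fixed by [g A], which is [A]. *)
Lemma stab_eigen g U : stabA g -> lifts g U ->
  forall w, ev (U (delta 0)) w = vac_coef U * delta_fun 0 w.
Proof.
move=> gK hU; apply: A_fixes_delta => a Aa.
have [g'S g'A] := stabA_inv varpi_unif beta_symp selfA_nform gK.
rewrite -(Sp_invK beta_symp gK.1 a); apply: (lifts_fixes hU).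
by apply: delta0_fixes; exact: g'A.
Qed.

Lemma lifts_scale g U a (phi1 phi : H) : lifts g U ->
  (forall w, ev phi w = a * ev phi1 w) -> forall w, ev (U phi) w = a * ev (U phi1) w.
Proof.
move=> hU h w; rewrite (lifts_lin hU (a := a) (phi1 := phi1) (phi2 := zeroH)).
  by rewrite (lifts_zero hU) addr0.
by move=> w'; rewrite h ev_zeroH addr0.
Qed.

Lemma stab_right g U h U1 : stabA g -> lifts g U -> lifts h U1 ->
  forall w, ev (U1 (U (delta 0))) w = vac_coef U * ev (U1 (delta 0)) w.
Proof.
move=> gK hU hU1; apply: (lifts_scale hU1) => w.
by rewrite (stab_eigen gK hU) ev_delta.
Qed.

(** * The metaplectic group on the stabilizer of A *)

Variable Mp : set ('End(W) * (H -> H)).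
Hypothesis Mp_meta : is_metaplectic Mp.

Lemma mp_lifts g U : Mp (g, U) -> lifts g U.
Proof. by move=> h; apply/Sp_hat_lifts/(mp_sub Mp_meta). Qed.

Lemma mp_Sp g U : Mp (g, U) -> Sp beta g.
Proof. by move=> /(mp_sub Mp_meta) []. Qed.

Lemma mp_inverse g U : Mp (g, U) ->
  exists U', [/\ Mp ((g^-1)%VF, U'), cancel U U' & cancel U' U].
Proof.
move=> h; have [_ [_ _ [U' UK KU]] _] := mp_sub Mp_meta h.
by exists U'; split => //; exact: (mp_inv Mp_meta h).
Qed.

Lemma stabA_one : stabA \1%VF.
Proof. by split=> [v w|a]; rewrite !lfunE. Qed.

Lemma mp_kernel_other : exists U0, [/\ Mp (\1%VF, U0), U0 <> id &
  forall U, Mp (\1%VF, U) -> U = id \/ U = U0].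
Proof.
have /eq_cardSP [U1 hU1 /eq_cardSP [U2 [hU2 n12] c0]] := mp_ker Mp_meta.
have all U : Mp (\1%VF, U) -> U = U1 \/ U = U2.
  move=> hU; apply: contrapT => /not_orP [n1 n2].
  by move: c0; rewrite II0 card_eq0 => /eqP /seteqP [/(_ U) h _]; apply: h.
have [e|e] := all _ (mp_one Mp_meta).
  by exists U2; rewrite e; split=> // ee; apply: n12.
exists U1; rewrite e; split=> [//|ee|U /all]; last by case; [right | left].
by apply: n12; rewrite ee.
Qed.

(** The nontrivial element [U0] of the kernel squares to the identity, and [vac_coef] is
    multiplicative on the kernel. *)
Lemma mp_kernel_sqr U : Mp (\1%VF, U) -> vac_coef U ^+ 2 = 1.
Proof.
have [U0 [h0 n0 all]] := mp_kernel_other.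
have y_id : vac_coef id ^+ 2 = 1 by rewrite /vac_coef ev_delta00 expr1n.
move=> /all [-> //|->] {U}.
have h00 : Mp (\1%VF, U0 \o U0) by have := mp_mul Mp_meta h0 h0; rewrite comp_lfun1l.
have [U' [_ UK _]] := mp_inverse h0.
have [e|e] := all _ h00; last first.
  case: n0; apply/funext => phi; have := congr1 (fun f => f phi) e.
  by move=> /= /(congr1 U'); rewrite !UK.
have := stab_right stabA_one (mp_lifts h0) (mp_lifts h0) 0.
by rewrite -[ev _ _]/(vac_coef (U0 \o U0)) e /vac_coef ev_delta00 -expr2 => <-.
Qed.

(* The inverse of U scales delta_0 too, so by adjunction U scales every value at 0. *)
Lemma stab_left g U phi : stabA g -> Mp (g, U) -> ev (U phi) 0 = vac_coef U * ev phi 0.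
Proof.
move=> gK hU; have [U' [hU' UK KU]] := mp_inverse hU.
have lU := mp_lifts hU; have lU' := mp_lifts hU'.
have adj (th : H) : ev (U th) 0 = (vac_coef U')^*%C * ev th 0.
  rewrite (lifts_adjoint lU lU' UK (s := [:: (vac_coef U', 0)])) ?big_seq1 // => w.
  rewrite /comb big_seq1 /=; apply: (stab_eigen _ lU').
  exact: (stabA_inv varpi_unif beta_symp selfA_nform gK).
by rewrite /vac_coef !adj ev_delta00 mulr1.
Qed.

Lemma vac_coef_compl g U U1 : stabA g -> Mp (g, U) ->
  vac_coef (U \o U1) = vac_coef U * vac_coef U1.
Proof. by move=> gK hU; rewrite /vac_coef /= (stab_left _ gK hU). Qed.

Lemma vac_coef_compr g U h U1 : stabA g -> Mp (g, U) -> Mp (h, U1) ->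
  vac_coef (U1 \o U) = vac_coef U1 * vac_coef U.
Proof.
move=> gK /mp_lifts hU /mp_lifts hU1.
by rewrite /vac_coef /= (stab_right gK hU hU1) mulrC.
Qed.

(** Two lifts of [g] differ by an element of the kernel, so the square depends on [g] alone. *)
Lemma vac_coef_same_sqr g U1 U2 : Mp (g, U1) -> Mp (g, U2) ->
  vac_coef U1 ^+ 2 = vac_coef U2 ^+ 2.
Proof.
move=> h1 h2; have [U2' [h2' K2 K2']] := mp_inverse h2.
have hk : Mp (\1%VF, U2' \o U1).
  have := mp_mul Mp_meta h2' h1.
  by rewrite (lker0_compVf (Sp_ker0 beta_symp (mp_Sp h2))).
have -> : U1 = U2 \o (U2' \o U1) by apply/funext => phi /=; rewrite K2'.
by rewrite (vac_coef_compr stabA_one hk h2) exprMn (mp_kernel_sqr hk) mulr1.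
Qed.

(** * Transvections along primitive vectors *)

Section HyperbolicDilation.
Variables e f : W.
Hypotheses (Ae : A e) (Af : A f) (ef : nb e f = 1).
Local Notation transv := (transv varpi beta lam).

Definition dilation : 'End(W) :=
  linfun (fun w => w + (((varpi - 1) * nb w f) *: e - ((varpi^-1 - 1) * nb w e) *: f)).

Lemma dilationE w : dilation w =
  w + (((varpi - 1) * nb w f) *: e - ((varpi^-1 - 1) * nb w e) *: f).
Proof.
rewrite /dilation linfunE // => a u v; rewrite !nformE !mulrDr !scalerDl !scalerDr.
rewrite scalerN !scalerA opprD [X in _ + X = _]addrACA [LHS]addrACA.
by rewrite (mulrCA (varpi - 1) a) (mulrCA (varpi^-1 - 1) a).
Qed.

Let fe : nb f e = -1.
Proof. by rewrite (nformC _ _ beta_symp) ef. Qed.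

Lemma dilation_Sp : Sp beta dilation.
Proof.
apply/(Sp_nform beta lam varpi_unif) => v w; rewrite !dilationE !nformE.
rewrite !(nformvv _ _ beta_symp) ef fe.
rewrite (nformC _ _ beta_symp e w) (nformC _ _ beta_symp f w).
have p0 := varpi_neq0 varpi_unif.
have := divff p0; move: (varpi^-1) => q pq.
transitivity (nb v w + (varpi * q - 1) * (nb v e * nb w f - nb v f * nb w e)); first ring.
by rewrite pq subrr mul0r addr0.
Qed.

Lemma dilation_e : dilation e = varpi *: e.
Proof.
rewrite dilationE ef (nformvv _ _ beta_symp) mulr0 scale0r subr0 mulr1.
by rewrite scalerBl scale1r subrKC.
Qed.

Lemma dilation_f : dilation f = varpi^-1 *: f.
Proof.
rewrite dilationE fe (nformvv _ _ beta_symp) mulr0 scale0r sub0r mulrN1 scaleNr opprK.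
by rewrite scalerBl scale1r subrKC.
Qed.

(** If [eta] is nonzero at [w], its invariance under the dilated lattice forces [w] into [c f + A]
    with [c f] in the dilated lattice. Equivariance and invariance then carry the nonzero value from
    [w] to 0. *)
Lemma dilation_ev0 U : Mp (dilation, U) -> ev (U (delta 0)) 0 != 0.
Proof.
move=> hU; have lU := mp_lifts hU; have [U' [_ UK _]] := mp_inverse hU.
set eta := U (delta 0).
have [w hw] : exists w, ev eta w != 0.
  apply: contrapT => /forallNP h.
  have e0 : delta 0 = zeroH.
    rewrite -[LHS]UK -[RHS]UK; congr U'; apply: ev_inj => w.
    by rewrite (lifts_zero lU); apply/eqP; have /negP := h w; rewrite negbK.
  by have := ev_delta00; rewrite e0 ev_zeroH => /esym/eqP; rewrite oner_eq0.
have fixh a : A a -> rho_fixes (dilation a) eta.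
  by move=> Aa; apply: (lifts_fixes lU); exact: delta0_fixes.
have p0 := varpi_neq0 varpi_unif.
have vp : lf_vge k 0 varpi by apply: vge_le (vge_varpiX varpi_unif 1).
(* The component of [w] along [f]. *)
pose c := - nb w e.
(* Integral multiples of [varpi *: e] lie both in [A] and in the dilated lattice, so [fixes_support]
   applies to them. *)
have hc : lf_vge k 0 (c * varpi).
  have : lf_vge k lam (beta w (varpi *: e)).
    apply: psi_vgeP => d hd; rewrite -betaZr -dilation_e -linearZ /=.
    have Ade : A (d *: e) by exact: AZ.
    apply: (fixes_support _ (fixh _ Ade)) => //.
    by rewrite linearZ /= dilation_e; apply/AZ/AZ.
  rewrite (beta_nform beta lam varpi_unif) => /(vge_varpiM varpi_unif).
  by rewrite subrr nformZr mulrC => /vgeN; rewrite -mulNr.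
have Aw : A (w - c *: f).
  apply: selfA_psi => a Aa.
  (* Without its component along [e], the vector [a] lies in the dilated lattice, and [w] pairs with
     it as [w - c f] does with [a]. *)
  pose a2 := a - nb a f *: e.
  have Aa2 : A a2 by apply: AB => //; apply: AZ => //;
    exact: (selfdual_nform selfA_nform).
  have ha2 : a2 = dilation (a2 + ((1 - varpi) * nb a2 e) *: f).
    rewrite linearD linearZ /= dilation_f dilationE.
    have -> : nb a2 f = 0 by rewrite !nformE ef mulr1 subrr.
    rewrite mulr0 scale0r sub0r scalerA -addrA -scaleNr -scalerDl.
    have -> : - ((varpi^-1 - 1) * nb a2 e) + (1 - varpi) * nb a2 e / varpi = 0 by field.
    by rewrite scale0r addr0.
  have h2 : psi (beta w a2) = 1.
    apply: (fixes_support _ _ hw) => //; rewrite ha2; apply: fixh.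
    apply: AD => //; apply: AZ => //; apply: vgeM0; first exact: (vgeB (vge1 k) vp).
    exact: (selfdual_nform selfA_nform).
  rewrite -h2; congr (psi _); rewrite /a2 !(beta_nform beta lam varpi_unif).
  rewrite !nformE (nformC _ _ beta_symp f a) /c; ring.
have Af' : A ((c * varpi) *: f) by exact: AZ.
have dcf : dilation ((c * varpi) *: f) = c *: f.
  by rewrite linearZ /= dilation_f scalerA mulfK.
apply: contraNneq hw => h0.
rewrite -[w](subrK (c *: f)) ev_equiv // -dcf.
have := fixh _ Af' 0; rewrite h0 add0r phase0l mul1r => <-.
by rewrite mulr0.
Qed.

Lemma transv_sqr_shift t U0 : lf_vge k 0 t -> Mp (transv e t, U0) ->
  exists2 U, Mp (transv e (varpi ^+ 2 * t), U) & vac_coef U = vac_coef U0.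
Proof.
move=> ht h0; have [Uh hh] := mp_surj Mp_meta dilation_Sp.
have [Uh' [hh' K K']] := mp_inverse hh.
have vp : lf_vge k 0 varpi by apply: vge_le (vge_varpiX varpi_unif 1).
pose U := Uh \o U0 \o Uh'.
have hU : Mp (transv e (varpi ^+ 2 * t), U).
  have := mp_mul Mp_meta (mp_mul Mp_meta hh h0) hh'.
  rewrite (transv_conj lam varpi_unif _ _ dilation_Sp) dilation_e transvZ -comp_lfunA.
  by rewrite (lker0_compfV (Sp_ker0 beta_symp dilation_Sp)) comp_lfun1r.
exists U => //.
have uK : stabA (transv e t) by exact: (stabA_transv varpi_unif beta_symp selfA_nform).
have uK2 : stabA (transv e (varpi ^+ 2 * t)).
  by apply: (stabA_transv varpi_unif beta_symp selfA_nform) => //; rewrite expr2;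
    apply: vgeM0 => //; exact: vgeM0.
(* Both scalars multiply the nonzero value of [Uh (delta 0)] at 0: one by conjugation, the other by
   [stab_left]. *)
apply: (mulIf (dilation_ev0 hh)).
rewrite -(stab_left _ uK2 hU) /U /= K.
by rewrite (stab_right uK (mp_lifts h0) (mp_lifts hh)).
Qed.

Lemma primitive_transv_sqr t U : lf_vge k 0 t -> Mp (transv e t, U) ->
  vac_coef U ^+ 2 = 1.
Proof.
move=> ht hU.
have vp : lf_vge k 1 varpi by exact: (vge_varpiX varpi_unif 1).
have ud : vunit (varpi ^+ 2 - 1).
  rewrite addrC; apply: vunitD; first exact/vunitN/vunit1.
  by rewrite expr2; apply: vgeM0 => //; apply: vge_le vp.
(* Chosen so that [varpi ^ 2 * s - s = t], which makes [transv e t] a quotient of two transvections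
   with equal coefficients. *)
pose s := t / (varpi ^+ 2 - 1).
have hs : lf_vge k 0 s by rewrite /s mulrC; apply: vgeM0 => //; exact/vunit_vge0/vunitV.
have [U0 h0] := mp_surj Mp_meta (transv_Sp lam varpi_unif beta_symp e s).
have [U1 h1 e1] := transv_sqr_shift hs h0.
have [U0' [h0' K0 K0']] := mp_inverse h0.
have hc : Mp (transv e t, U1 \o U0').
  have := mp_mul Mp_meta h1 h0'; rewrite (transvV lam varpi_unif beta_symp) -transvD //.
  suff -> : varpi ^+ 2 * s - s = t by [].
  by rewrite -{2}[s]mul1r -mulrBl mulrC divfK //; case: ud.
have vpx : lf_vge k 0 varpi by apply: vge_le vp.
have uK : stabA (transv e s) by exact: (stabA_transv varpi_unif beta_symp selfA_nform).
have uK2 : stabA (transv e (varpi ^+ 2 * s)).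
  by apply: (stabA_transv varpi_unif beta_symp selfA_nform) => //; rewrite expr2;
    apply: vgeM0 => //; exact: vgeM0.
rewrite (vac_coef_same_sqr hU hc) (vac_coef_compl _ uK2 h1) e1 -(vac_coef_compl _ uK h0).
have -> : U0 \o U0' = id by apply/funext => phi /=; rewrite K0'.
by rewrite /vac_coef ev_delta00 expr1n.
Qed.

End HyperbolicDilation.

(** A nonzero [e] is [varpi ^ n] times a primitive vector with [n >= 0], and this power moves into
    [t] as its square. *)
Lemma transv_sqr e t U : A e -> lf_vge k 0 t -> Mp (transv varpi beta lam e t, U) ->
  vac_coef U ^+ 2 = 1.
Proof.
move=> Ae ht hU; have [e0|e0] := eqVneq e 0.
  apply: mp_kernel_sqr; move: hU; congr (Mp (_, _)); apply/lfunP => w.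
  by rewrite transvE e0 scaler0 addr0 lfunE.
have [e1 [f [n [Ae1 Af ef we hn]]]] :=
  primitive_pair varpi_unif beta_symp selfA_nform selfA_absorb e0.
move: hU; rewrite we transvZ; apply: (primitive_transv_sqr Ae1 Af ef).
apply: vgeM0 => //; rewrite expr2.
have hv : lf_vge k 0 (varpi ^ n) by right; rewrite val_varpiX //; exact: hn.
exact: vgeM0.
Qed.

(** If the equation holds for all lifts of [u g], with [u] an integral transvection along [A], it
    holds for those of [g]; so [transv_generation] applies. *)
Lemma stab_sqr g U : stabA g -> Mp (g, U) -> vac_coef U ^+ 2 = 1.
Proof.
move=> gK; move: g gK U.
apply: (transv_generation varpi_unif beta_symp selfA_nform selfA_absorb).
  exact: mp_kernel_sqr.
move=> e t g Ae ht gK IH U hU.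
have [Uu hu] := mp_surj Mp_meta (transv_Sp lam varpi_unif beta_symp e t).
have uK : stabA (transv varpi beta lam e t) by exact: (stabA_transv varpi_unif
  beta_symp selfA_nform).
have := IH _ (mp_mul Mp_meta hu hU).
by rewrite (vac_coef_compl _ uK hu) exprMn (transv_sqr Ae ht hu) mul1r.
Qed.

(** * The stabilizer of B *)

Lemma res_charD a b : psib (a + b) = psib a * psib b.
Proof.
have [ia ea] := res_liftP a; have [ib eb] := res_liftP b.
have iab : integers k (res_lift a + res_lift b) by exact: vgeD.
rewrite -{1}ea -{1}eb -lf_resD // res_charE // mulrDr psiD.
by rewrite -!res_charE // ea eb.
Qed.

Lemma res_char_norm a : `|psib a| = 1.
Proof. by case: psi_char => _; exact. Qed.

Lemma res_char_neq1 : exists a, psib a != 1.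
Proof.
case: psi_cond => _ [_ [z iz <-] /eqP nz].
by exists (lf_res z); rewrite res_charE.
Qed.

Local Notation G := (gauss psib 1 ^+ 2).

Lemma gauss_one_neq0 : gauss psib 1 != 0.
Proof.
have := gauss_norm (two_res_neq0 res_char_neq2) res_charD res_char_norm res_char_neq1
  (oner_neq0 F).
move=> e; apply/eqP => g0; move: e; rewrite g0 mul0r => /esym/eqP.
by rewrite pnatr_eq0 -leqn0 leqNgt (cardD1 0).
Qed.

Lemma gauss_sqr_eq (a : F) : a != 0 -> gauss psib a ^+ 2 = G.
Proof.
move=> a0; have := gauss_sign (two_res_neq0 res_char_neq2) res_charD res_char_neq1 a0.
by case=> ->; rewrite ?sqrrN.
Qed.

Lemma gauss_conj_one : (gauss psib 1)^*%C = gauss psib (-1).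
Proof. exact: (gauss_conj res_charD res_char_norm). Qed.

Lemma G_conj : G^*%C = G.
Proof. by rewrite rmorphXn /= gauss_conj_one gauss_sqr_eq // oppr_eq0 oner_neq0. Qed.

(** [G] is real, since [gauss (-1)] and [gauss 1] have the same square; hence its square is that of
    [gauss 1] times its conjugate. *)
Lemma G_sqr : G ^+ 2 = #|F|%:R ^+ 2.
Proof.
rewrite expr2 -{2}G_conj rmorphXn /= -exprMn.
by rewrite (gauss_norm (two_res_neq0 res_char_neq2) res_charD res_char_norm
  res_char_neq1) ?oner_neq0.
Qed.

Local Notation stabB := (lattice_stabilizer beta B).

Lemma stabB_lattice g v : stabB g -> B v -> B (g v).
Proof. by move=> [_ gB] Bv; rewrite -gB; exists v. Qed.

Lemma stabB_dual g v : stabB g -> Bs v -> Bs (g v).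
Proof. exact: stab_dual. Qed.

Lemma stabB_inv g : stabB g -> stabB (g^-1)%VF.
Proof.
move=> [gS gB]; split; first exact: (Sp_inv beta_symp gS).
apply/seteqP; split=> [_ [v Bv <-]|v Bv].
  have [u Bu <-] : (g @` B) v by rewrite gB.
  by rewrite (Sp_Kinv beta_symp gS).
by exists (g v); [rewrite -gB; exists v | rewrite (Sp_Kinv beta_symp gS)].
Qed.

Lemma stabB_comp g h : stabB g -> stabB h -> stabB (g \o h)%VF.
Proof.
move=> [gS gB] [hS hB]; split; first exact: Sp_comp.
apply/seteqP; split=> [_ [v Bv <-]|v Bv].
  by rewrite comp_lfunE; apply: stabB_lattice => //; exact: stabB_lattice.
have [u Bu <-] : (g @` B) v by rewrite gB.
have [t Bt <-] : (h @` B) u by rewrite hB.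
by exists t => //; rewrite comp_lfunE.
Qed.

(** Vectors of [B] are displaced by integral multiples of [varpi *: e], which lies in [B] because
    the lattice is good. *)
Lemma stabB_transv e t : Bs e -> lf_vge k 1 t -> stabB (transv varpi beta lam e t).
Proof.
move=> he ht.
have sub s v : lf_vge k 1 s -> B v -> B (transv varpi beta lam e s v).
  have [[B0 BD BZ _ _] hB _] := B_good.
  move=> hs Bv; rewrite transvE; apply: BD => //.
  have -> : (s * nb v e) *: e = (varpi ^ (-1) * (s * nb v e)) *: (varpi *: e).
    by rewrite scalerA mulrAC exprN1 mulVf ?mul1r // varpi_neq0.
  apply: BZ; last by apply: hB; exists e.
  apply/(vge_varpiM varpi_unif); rewrite sub0r opprK mulrC; apply: vgeM0 => //.
  rewrite (nformC _ _ beta_symp); apply: vgeN; apply/(vge_varpiM varpi_unif).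
  by rewrite sub0r opprK; apply: (dual_vge e).1.
split; first exact: (transv_Sp lam varpi_unif beta_symp).
apply/seteqP; split=> [_ [v Bv <-]|v Bv]; first exact: sub.
exists (transv varpi beta lam e (- t) v); first by apply: sub => //; exact: vgeN.
by rewrite -comp_lfunE -(transvD varpi lam beta_symp) subrr transv0 lfunE.
Qed.

Local Notation lift := (@qs_lift k varpi W beta lam B V).

Lemma liftA a : a \in x -> A (lift a).
Proof. by move=> ax; have [h e] := qs_liftP a; split; rewrite ?e. Qed.

Lemma delta_shift a w w' : A a -> delta_fun (a + w) w' = ph a w * delta_fun w w'.
Proof.
move=> Aa; have [h|h] := pselect (A (w' - w)); last first.
  rewrite !delta_funF ?mulr0 // => h'; apply: h.
  have -> : w' - w = w' - (a + w) + a by rewrite opprD addrA addrAC subrK.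
  exact: AD.
rewrite !delta_funT //; last by rewrite opprD addrA addrAC; exact: AB.
by rewrite phaseDl -{1}[w'](subrK w) phaseDr (phaseA Aa h) mul1r.
Qed.

(** The difference [u - w] is in [B], hence in [A], and has trivial phase against [Bs]. *)
Lemma delta_res u w : Bs u -> Bs w -> pr u = pr w -> delta_fun u =1 delta_fun w.
Proof.
move=> hu hw e w'.
have Buw : B (u - w).
  by apply/(qs_ker V); [exact: dual_latticeB | rewrite qs_prB // e subrr].
have := phaseVl w (u - w); rewrite (phaseB hw Buw) mul1r => phw.
by rewrite -{1}[u](subrK w) delta_shift ?phw ?mul1r //; exact: lattice_selfA.
Qed.

(** * Sums over the Lagrangian *)

Definition sumx (Fn : V -> C) : C := \sum_(a : finvect_type V | (a : V) \in x) Fn a.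

Lemma eq_sumx (F1 F2 : V -> C) : (forall a, a \in x -> F1 a = F2 a) -> sumx F1 = sumx F2.
Proof. by move=> h; apply: eq_bigr. Qed.

Lemma mulr_sumx c (Fn : V -> C) : c * sumx Fn = sumx (fun a => c * Fn a).
Proof. exact: mulr_sumr. Qed.

Lemma sumx_shift (Fn : V -> C) b : b \in x -> sumx Fn = sumx (fun a => Fn (a - b)).
Proof.
move=> bx; have inj : injective (fun v : finvect_type V => (v : V) - b : finvect_type V).
  by move=> u v /(congr1 (fun y : V => y + b)) /=; rewrite !subrK.
rewrite /sumx (reindex_inj inj); apply: eq_bigl => a /=.
by rewrite rpredBr.
Qed.

Lemma sumx_const c : sumx (fun=> c) = card_x%:R * c.
Proof. by rewrite /sumx sumr_const mulr_natl. Qed.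

(** One list serves every summand [T], as both [comb] and the adjoint formula use it. *)
Lemma sumx_comb (h : V -> C * W) : exists s : seq (C * W),
  forall T : C * W -> C, \sum_(i <- s) T i = sumx (fun a => T (h a)).
Proof.
exists (map (fun a : finvect_type V =>
  h a) (enum [pred a : finvect_type V | (a : V) \in x])) => T.
by rewrite big_map big_enum.
Qed.

(** The cardinality of the intersection of [x] with its image under the residue of [g]; see
    [card_meet_dim]. *)
Definition card_meet (g : 'End(W)) : nat :=
  #|[pred a : finvect_type V | ((a : V) \in x) && (pr ((g^-1)%VF (lift a)) \in x)]|.

Lemma card_meet_sum g : sumx (fun a => (pr ((g^-1)%VF (lift a)) \in x)%:R) =
  (card_meet g)%:R.
Proof.
rewrite /sumx /card_meet -sum1_card natr_sum [RHS]big_mkcond [LHS]big_mkcond.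
apply: eq_bigr => a _; rewrite inE.
by case: ((a : V) \in x) => //=; case: (_ \in x).
Qed.

Lemma pr_stabB g u w : stabB g -> Bs u -> Bs w -> pr u = pr w -> pr (g u) = pr (g w).
Proof.
by move=> gK hu hw e; rewrite -!(res_mapE V varpi_unif B_good gK) // e.
Qed.

Lemma delta_fun0 g a : stabB g -> a \in x ->
  delta_fun 0 ((g^-1)%VF (lift a)) = (pr ((g^-1)%VF (lift a)) \in x)%:R.
Proof.
move=> gK ax; have [h e] := qs_liftP a; have h' := stabB_dual (stabB_inv gK) h.
case: (boolP (pr _ \in x)) => hx.
  by rewrite delta_funT ?subr0 ?phase0l.
by rewrite delta_funF ?subr0 // => -[_]; apply/negP.
Qed.

(** * Explicit formula for the lifts of elements stabilizing [B] *)

Section Formula.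
Variables (g : 'End(W)) (U : H -> H).
Hypotheses (gK : stabB g) (hU : Mp (g, U)).
Local Notation g' := (g^-1)%VF.

Let gS : Sp beta g. Proof. by case: gK. Qed.
Let g'S : Sp beta g'. Proof. exact: (Sp_inv beta_symp gS). Qed.
Let g'K : stabB g'. Proof. exact: stabB_inv. Qed.

Lemma phase_Sp h u v : Sp beta h -> ph (h u) (h v) = ph u v.
Proof. by move=> hS; rewrite /phase hS. Qed.

Lemma pr_lift_diff a b : a \in x -> b \in x ->
  A (g' (lift a) - g' (lift b)) <-> pr (g' (lift (a - b))) \in x.
Proof.
move=> ax bx; have [ha ea] := qs_liftP a; have [hb eb] := qs_liftP b.
have [hc ec] := qs_liftP (a - b).
have hab : Bs (lift a - lift b) by exact: dual_latticeB.
have -> : pr (g' (lift (a - b))) = pr (g' (lift a - lift b)).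
  by apply: pr_stabB => //; rewrite ec qs_prB // ea eb.
rewrite -linearB /=; split=> [[] //|h]; split => //; exact: stabB_dual.
Qed.

(** The sum runs over representatives of [g^-1 A] modulo [B]; translation by an element of [g^-1 A]
    permutes them, with trivial phases by self-duality. *)
Lemma invariant_vector : exists P : H,
  (forall w, ev P w = sumx (fun a => delta_fun (g' (lift a)) w)) /\
  (forall a, A a -> rho_fixes (g' a) P).
Proof.
have [s hs] := sumx_comb (fun a => (1, g' (lift a))).
have [P hP] := comb_ex s zeroH.
have evP w : ev P w = sumx (fun a => delta_fun (g' (lift a)) w).
  rewrite hP ev_zeroH addr0 /comb hs; apply: eq_sumx => a _; by rewrite mul1r.
exists P; split=> // c [hc cx] w; rewrite !evP.
have Ac : A c by split.
rewrite mulr_sumx (@sumx_shift (fun a => delta_fun (g' (lift a)) w) (pr c)) //.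
apply: eq_sumx => a ax; rewrite rho_delta phase_Sp // (phaseA (liftA ax) Ac) mul1r.
have [ha ea] := qs_liftP a; have [hd ed] := qs_liftP (a - pr c).
rewrite -linearB /=; apply: delta_res; try apply: stabB_dual => //.
  exact: dual_latticeB.
apply: pr_stabB => //; first exact: dual_latticeB.
by rewrite ed qs_prB // ea.
Qed.

Lemma card_meet_gt0 : (0 < card_meet g)%N.
Proof.
apply/card_gt0P; exists (0 : V); rewrite inE mem0v /=.
have [h e] := qs_liftP (0 : V); have Bl : B (lift 0) by apply/(qs_ker V).
by case: (lattice_selfA (stabB_lattice g'K Bl)).
Qed.

(** [U P] is fixed by [A], so it is a multiple [c] of [delta 0]. Thus the inverse of [U] sends
    [delta 0] to [P / c], and adjunction gives the formula with [gamma] the conjugate of [1 / c]. *)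
Lemma main_formula : exists gamma : C,
  gamma * gamma^*%C * (card_x%:R * (card_meet g)%:R) = 1 /\
  forall phi w, ev (U phi) w =
    gamma * sumx (fun a => ph (lift a) w * ev phi (g' (lift a + w))).
Proof.
have [U' [hU' UK KU]] := mp_inverse hU.
have lU := mp_lifts hU; have lU' := mp_lifts hU'.
have [P [evP fixP]] := invariant_vector.
have UP : forall w, ev (U P) w = ev (U P) 0 * delta_fun 0 w.
  apply: A_fixes_delta => a Aa; rewrite -(Sp_invK beta_symp gS a).
  exact/(lifts_fixes lU)/fixP.
set c := ev (U P) 0 in UP.
have evPU w : ev P w = c * ev (U' (delta 0)) w.
  rewrite -{1}[P]UK; apply: (lifts_scale lU') => w'.
  by rewrite UP ev_delta.
have evPg a : a \in x -> ev P (g' (lift a)) = (card_meet g)%:R.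
  move=> ax; rewrite evP -card_meet_sum.
  rewrite (@sumx_shift (fun b => (pr (g' (lift b)) \in x)%:R) a) //.
  apply: eq_sumx => b bx.
  have [h|h] := pselect (A (g' (lift a) - g' (lift b))).
    rewrite delta_funT // phase_Sp // (phaseA (liftA bx) (liftA ax)).
    suff -> : pr (g' (lift (b - a))) \in x by [].
    by apply/pr_lift_diff => //; rewrite -opprB; exact: AN.
  rewrite delta_funF //; case: (boolP (pr _ \in x)) => // /pr_lift_diff h'; case: h.
  by rewrite -opprB; apply: AN; exact: h'.
have c0 : c != 0.
  apply/eqP => c0; have := evPg 0 (mem0v x); rewrite evPU c0 mul0r => /esym/eqP.
  by rewrite pnatr_eq0 -leqn0 leqNgt card_meet_gt0.
have evU' w : ev (U' (delta 0)) w = c^-1 * ev P w by rewrite evPU mulKf.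
have form phi w : ev (U phi) w =
    (c^-1)^*%C * sumx (fun a => ph (lift a) w * ev phi (g' (lift a + w))).
  have [s hs] := sumx_comb (fun a => (c^-1 * ph w (lift a), g' (lift a + w))).
  rewrite (lifts_adjoint lU lU' UK (s := s)).
    rewrite hs mulr_sumx; apply: eq_sumx => a _ /=.
    by rewrite rmorphM /= phase_conj mulrA.
  (* [delta w] is the translate of [delta 0] by [- w]. *)
  move=> w'; rewrite (lifts_rho lU' (u := - w) (phi := delta 0)); last first.
    move=> w2; rewrite !ev_delta rho_delta phase0l mul1r opprK add0r //.
  rewrite evU' evP /comb hs [in RHS]/= mulrCA mulr_sumx mulr_sumx.
  apply: eq_sumx => a _; rewrite linearN /= rho_delta phaseNr phase_Sp //
    opprK linearD /=.
  by rewrite mulrA.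
exists (c^-1)^*%C; split=> //; rewrite conjcK.
(* Since [U] maps this vector back to [delta 0], the formula at 0 gives the modulus of [gamma]. *)
have := form (U' (delta 0)) 0; rewrite KU ev_delta00 => e.
rewrite [RHS]e -mulrA; congr (_ * _).
rewrite -(sumx_const) mulr_sumx; apply: eq_sumx => a ax.
by rewrite phase0r mul1r addr0 evU' evPg.
Qed.

Lemma vac_coef_formula gamma :
  (forall phi w, ev (U phi) w =
    gamma * sumx (fun a => ph (lift a) w * ev phi (g' (lift a + w)))) ->
  vac_coef U = gamma * (card_meet g)%:R.
Proof.
move=> h; rewrite /vac_coef h -card_meet_sum; congr (_ * _); apply: eq_sumx => a ax.
by rewrite phase0r mul1r addr0 ev_delta delta_fun0.
Qed.

Lemma vac_coef_norm : vac_coef U * (vac_coef U)^*%C * card_x%:R = (card_meet g)%:R.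
Proof.
have [gamma [hn form]] := main_formula;
  rewrite (vac_coef_formula form) rmorphM /= conjc_nat.
transitivity (gamma * gamma^*%C * (card_x%:R * (card_meet g)%:R) * (card_meet g)%:R);
  first ring.
by rewrite hn mul1r.
Qed.

End Formula.

Lemma betabB u v w c : betab (u - c *: v) w = betab u w - c * betab v w.
Proof.
have [hu eu] := qs_liftP u; have [hv ev] := qs_liftP v; have [hw ew] := qs_liftP w.
have [ic ec] := res_liftP c.
have hcv := dual_latticeZ varpi_unif ic hv.
rewrite -[in LHS]eu -[in LHS]ev -[in LHS]ew -[in LHS]ec -qs_prZ // -qs_prB //.
rewrite res_formE //; last exact: dual_latticeB.
have i1 := beta_dual varpi_unif B_good hu hw.
have i2 := beta_dual varpi_unif B_good hv hw.
rewrite betaDl betaNl betaZl mulrBr mulrCA (lf_resB i1 (vgeM0 ic i2)) (lf_resM ic i2).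
rewrite ec -(res_formE V varpi_unif beta_symp B_good hu hw).
by rewrite -(res_formE V varpi_unif beta_symp B_good hv hw) eu ev ew.
Qed.

(* Averaging over the translates by multiples of d avoids counting the fibres of L. *)
Lemma sumx_linear (L : V -> F) (d : V) (h : F -> C) : d \in x ->
  (forall a c, L (a - c *: d) = L a + c) ->
  #|F|%:R * sumx (fun a => h (L a)) = card_x%:R * \sum_c h c.
Proof.
move=> dx hL; transitivity (\sum_(c : F) sumx (fun a => h (L a))).
  by rewrite sumr_const mulr_natl.
rewrite -sumx_const.
transitivity (\sum_(c : F) sumx (fun a => h (L a + c))).
  apply: eq_bigr => c _; rewrite (@sumx_shift (fun a => h (L a)) (c *: d)) ?rpredZ //.
  by apply: eq_sumx => a _; rewrite hL.
rewrite /sumx exchange_big; apply: eq_bigr => a _ /=.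
by rewrite [RHS](reindex_inj (addrI (L a))).
Qed.

(** * Reduction to the stabilizer of A *)

(** Equivariance under [A] and invariance under [g A] determine [U (delta 0)] on [A + g A] by its
    value at 0. *)
Lemma ev_stab g U d c : lifts g U -> A d -> A c ->
  ev (U (delta 0)) (d + g c) = ph (g c) d * vac_coef U.
Proof.
move=> lU Ad Ac; rewrite ev_equiv //; congr (_ * _).
by have := lifts_fixes lU (delta0_fixes Ac) 0;
  rewrite add0r phase0l mul1r /vac_coef => ->.
Qed.

Section ReductionStep.
Variables (g : 'End(W)) (a0 a : W).
Hypotheses (gK : stabB g) (Aa0 : A a0) (Aa : A a).
Hypothesis not_orth : ~ lf_vge k lam (beta (g a0) a).
Local Notation transv := (transv varpi beta lam).
Let a' := g a0.
Let mu := varpi ^ (1 - lam) * beta a' a.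
(** Chosen so that [t * nb a' a = -1], whence [h] sends [a'] to [a' - a]. *)
Let t := - varpi / mu.

Let ha : Bs a. Proof. by case: Aa. Qed.
Let ha' : Bs a'. Proof. by apply: stabB_dual => //; case: Aa0. Qed.

Let mu_unit : vunit mu.
Proof.
apply: vunitP; first exact: (beta_dual varpi_unif B_good).
by move=> /(vge_varpiM varpi_unif); rewrite opprB addrC subrK.
Qed.

Let muE : mu = varpi * nb a' a.
Proof. by rewrite /mu /nform expfzDr ?varpi_neq0 // expr1z mulrA. Qed.

Let vge_t : lf_vge k 1 t.
Proof.
rewrite /t mulrC; apply: vgeM0; first exact/vunit_vge0/vunitV.
exact/vgeN/(vge_varpiX varpi_unif 1).
Qed.

Let t_nform : t * nb a' a = -1.
Proof.
have [mu0 _] := mu_unit; have p0 := varpi_neq0 varpi_unif.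
by rewrite /t mulrAC mulNr -muE mulNr divff.
Qed.

(** The inverse of [v] sends [d] to [d + coeff d *: a']. *)
Let coeff (d : W) : k := - t * nb d a'.

Let coeffE d : coeff d = (varpi ^ (1 - lam) * beta d a') / mu.
Proof.
by rewrite /coeff /t /nform expfzDr ?varpi_neq0 // expr1z; ring.
Qed.

Let vge_coeff d : A d -> lf_vge k 0 (coeff d).
Proof.
move=> [hd _]; rewrite coeffE mulrC; apply: vgeM0; first exact/vunit_vge0/vunitV.
exact: (beta_dual varpi_unif B_good).
Qed.

Let coeff_beta d : beta a' d = - coeff d * beta a' a.
Proof.
rewrite (beta_asym _ _ beta_symp) !(beta_nform beta lam varpi_unif) /coeff.
have -> : - (- t * nb d a') * (varpi ^ lam * nb a' a) =
  varpi ^ lam * nb d a' * (t * nb a' a) by ring.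
by rewrite t_nform mulrN1.
Qed.

Let v := transv a' t.
Let h := transv a t.

Let vV d : (v^-1)%VF d = d + coeff d *: a'.
Proof. by rewrite /v (transvV lam varpi_unif beta_symp) transvE. Qed.

Let vK : stabB v. Proof. exact: stabB_transv. Qed.
Let hK : stabB h. Proof. exact: stabB_transv. Qed.
Let vge_t0 : lf_vge k 0 t. Proof. by apply: vge_le vge_t. Qed.
Let hA : stabA h.
Proof. exact: (stabA_transv varpi_unif beta_symp selfA_nform). Qed.

Let h_a' : h a' = a' - a.
Proof. by rewrite /h transvE t_nform scaleN1r. Qed.

(** As a function of the residue of [d], the phase is the summand of a quadratic Gauss sum. *)
Let phase_coeff d : A d ->
  ph (coeff d *: a') d =
    psib (2^-1 * - lf_res mu * (betab (pr d) (pr a') / lf_res mu) ^+ 2).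
Proof.
move=> Ad; have [hd _] := Ad; have im := vunit_vge0 mu_unit.
have ic := vge_coeff Ad.
have es : lf_res (coeff d) = betab (pr d) (pr a') / lf_res mu.
  have mu0 : lf_res mu != 0.
    by apply/eqP => /(lf_res_ker im); exact: vunit_vge1.
  apply: (mulIf mu0); rewrite divfK // -lf_resM // res_formE //; congr lf_res.
  by rewrite coeffE divfK //; case: mu_unit.
have i2 := vge_half res_char_neq2.
have iN := vgeN im.
rewrite -es -(lf_res_half res_char_neq2) -lf_resN // expr2.
have iss := vgeM0 ic ic; have i2N := vgeM0 i2 iN.
rewrite -(lf_resM ic ic) -(lf_resM i2 iN) -(lf_resM i2N iss) res_charE //;
  last exact: vgeM0.
rewrite /phase betaZl coeff_beta; congr (psi _); rewrite /mu.
have e : varpi ^ (lam - 1) * varpi ^ (1 - lam) = 1.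
  by rewrite -expfzDr ?varpi_neq0 // addrA subrK subrr expr0z.
by rewrite -[LHS]mul1r -e; ring.
Qed.

Variables U Uv Uh : H -> H.
Hypotheses (hU : Mp (g, U)) (hUv : Mp (v, Uv)) (hUh : Mp (h, Uh)).

Let form_sum gamma (U1 : H -> H) :
  (forall phi w, ev (Uv phi) w =
    gamma * sumx (fun a => ph (lift a) w * ev phi ((v^-1)%VF (lift a + w)))) ->
  vac_coef (Uv \o U1) = gamma * sumx (fun b =>
    ev (U1 (delta 0)) (lift b + coeff (lift b) *: a')).
Proof.
move=> form; rewrite /vac_coef /= form; congr (_ * _); apply: eq_sumx => b bx.
by rewrite phase0r mul1r addr0 vV.
Qed.

(** [v g = g u], where [u] is the transvection along [a0], which stabilizes [A]. *)
Let step_same : vac_coef (Uv \o U) ^+ 2 = vac_coef U ^+ 2.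
Proof.
have [Ua hUa] := mp_surj Mp_meta (transv_Sp lam varpi_unif beta_symp a0 t).
have aK : stabA (transv a0 t) by exact: (stabA_transv varpi_unif beta_symp selfA_nform).
have := mp_mul Mp_meta hU hUa; rewrite (transv_conj lam varpi_unif _ _ gK.1) => hUUa.
rewrite (vac_coef_same_sqr (mp_mul Mp_meta hUv hU) hUUa) (vac_coef_compr aK hUa hU).
by rewrite exprMn (stab_sqr aK hUa) mulr1.
Qed.

(** Applying [Uv] to [U (delta 0)] produces the Gauss sum [S]; after [Uh] is inserted, the phases
    disappear and [card_x] replaces [S]. Since [v g] and [h g] have the same squared coefficient as
    [g], the factor is determined, using [G ^ 2 = q ^ 2]. *)
Lemma reduction_step : vac_coef (Uv \o (Uh \o U)) ^+ 2 = G * vac_coef U ^+ 2.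
Proof.
have [gamma [_ form]] := main_formula vK hUv.
have hU1 := mp_mul Mp_meta hUh hU.
have eq1 : vac_coef (Uh \o U) ^+ 2 = vac_coef U ^+ 2.
  by rewrite (vac_coef_compl _ hA hUh) exprMn (stab_sqr hA hUh) mul1r.
pose L (b : V) := betab b (pr a') / lf_res mu.
pose S := sumx (fun b => psib (2^-1 * - lf_res mu * L b ^+ 2)).
have e1 : vac_coef (Uv \o U) = gamma * S * vac_coef U.
  rewrite (form_sum _ form) -mulrA; congr (_ * _).
  rewrite mulrC mulr_sumx; apply: eq_sumx => b bx.
  have Ab := liftA bx; have [hb eb] := qs_liftP b.
  have Ac : A (coeff (lift b) *: a0) by apply: AZ => //; exact: vge_coeff.
  have eg : coeff (lift b) *: a' = g (coeff (lift b) *: a0) by rewrite linearZ.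
  rewrite eg (ev_stab (mp_lifts hU) Ab Ac) -eg phase_coeff // eb mulrC.
  by [].
have e2 : vac_coef (Uv \o (Uh \o U)) = gamma * card_x%:R * vac_coef (Uh \o U).
  rewrite (form_sum _ form) -mulrA; congr (_ * _).
  rewrite -sumx_const; apply: eq_sumx => b bx.
  have Ab := liftA bx; set d := lift b in Ab *.
  have ic := vge_coeff Ab.
  have Ac : A (coeff d *: a0) by exact: AZ.
  have eg : (h \o g)%VF (coeff d *: a0) = coeff d *: (a' - a).
    by rewrite comp_lfunE !linearZ /= -/a' h_a'.
  (* The point is regrouped as an element of [A] plus one of [h g A]; this time their mutual phase
     is trivial. *)
  have -> : d + coeff d *: a' = (d + coeff d *: a) + (h \o g)%VF (coeff d *: a0).
    by rewrite eg scalerBr addrACA subrr addr0.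
  have Ada : A (d + coeff d *: a) by apply: AD => //; exact: AZ.
  rewrite (ev_stab (mp_lifts hU1) Ada Ac) eg phase_vge ?mul1r //.
  have -> : beta (coeff d *: (a' - a)) (d + coeff d *: a) = - coeff d * beta a d.
    by rewrite !betaE coeff_beta (beta_symp.1 a); ring.
  by apply: vgeM0; [exact: vgeN | exact: selfA_beta].
have mu0 : lf_res mu != 0.
  by apply/eqP => /(lf_res_ker (vunit_vge0 mu_unit)); exact: vunit_vge1.
(* [L] takes the value -1 at [pr a], so translating along [pr a] runs through all values of [L]. *)
have hS : #|F|%:R * S = card_x%:R * gauss psib (- lf_res mu).
  have [_ ax] := Aa.
  apply: (sumx_linear (fun y => psib (2^-1 * - lf_res mu * y ^+ 2)) ax) => b c.
  rewrite /L betabB (res_formE V varpi_unif beta_symp B_good ha ha').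
  rewrite (beta_asym _ _ beta_symp) mulrN -/mu lf_resN; last exact/vunit_vge0/mu_unit.
  by rewrite mulrN opprK mulrDl mulfK.
have hG : gauss psib (- lf_res mu) ^+ 2 = G by apply: gauss_sqr_eq; rewrite oppr_eq0.
have G0 : G != 0 by rewrite expf_neq0 // gauss_one_neq0.
rewrite e2 exprMn eq1; apply: (mulfI G0).
have : #|F|%:R ^+ 2 * vac_coef (Uv \o U) ^+ 2 =
  (gamma * card_x%:R) ^+ 2 * G * vac_coef U ^+ 2.
  rewrite e1 -hG; transitivity ((gamma * (#|F|%:R * S) * vac_coef U) ^+ 2); first ring.
  by rewrite hS; ring.
by rewrite step_same -G_sqr => e3; rewrite mulrA (mulrC G) -e3; ring.
Qed.

End ReductionStep.

Lemma card_meet_le g : (card_meet g <= card_x)%N.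
Proof.
by apply/subset_leq_card/fintype.subsetP => b; rewrite !inE => /andP[].
Qed.

Lemma card_meet_stabA g : stabA g -> card_meet g = card_x.
Proof.
move=> gA; have [_ g'A] := stabA_inv varpi_unif beta_symp selfA_nform gA.
apply: eq_card => b; rewrite !inE; case: (boolP ((b : V) \in x)) => //= bx.
by case: (g'A _ (liftA bx)).
Qed.

(** By [vac_coef_norm] the modulus of [vac_coef] determines [card_meet], and [G] has modulus [q]. *)
Lemma card_meet_step g U g2 U2 : stabB g -> stabB g2 -> Mp (g, U) -> Mp (g2, U2) ->
  vac_coef U2 ^+ 2 = G * vac_coef U ^+ 2 -> card_meet g2 = (#|F| * card_meet g)%N.
Proof.
move=> gK gK2 hU hU2 e.
have n1 := vac_coef_norm gK hU; have n2 := vac_coef_norm gK2 hU2.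
apply/eqP; rewrite -eqn_sqr -(eqr_nat C) natrX natrX natrM -n1 -n2; apply/eqP.
have -> : (vac_coef U2 * (vac_coef U2)^*%C * card_x%:R) ^+ 2 =
   vac_coef U2 ^+ 2 * (vac_coef U2 ^+ 2)^*%C * card_x%:R ^+ 2 by rewrite rmorphXn /=;
     ring.
rewrite e rmorphM /= G_conj rmorphXn /= exprMn -G_sqr; ring.
Qed.

(** [j] counts the reduction steps needed to reach the stabilizer of [A]; each multiplies
    [card_meet] by [q], and [card_x] bounds it. *)
Lemma vac_coef_power g : stabB g -> exists j, (card_meet g * #|F| ^ j)%N = card_x /\
  forall U, Mp (g, U) -> vac_coef U ^+ 2 * G ^+ j = 1.
Proof.
have [n] := ubnP (card_x - card_meet g); elim: n g => // n IH g le_n gK.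
have [gA|nA] := pselect (stabA g).
  exists 0%N; split=> [|U hU]; first by rewrite muln1 card_meet_stabA.
  by rewrite mulr1 (stab_sqr gA hU).
have [a0 Aa0 [a Aa nv]] : exists2 a0, A a0 &
    exists2 a, A a & ~ lf_vge k lam (beta (g a0) a).
  apply: contrapT => h; apply: nA; split; first by case: gK.
  move=> a0 Aa0; apply/selfA_selfdual => a Aa; apply: contrapT => nv.
  by apply: h; exists a0 => //; exists a.
set t := - varpi / (varpi ^ (1 - lam) * beta (g a0) a).
set v := transv varpi beta lam (g a0) t; set h := transv varpi beta lam a t.
have [Uv hUv] := mp_surj Mp_meta (transv_Sp lam varpi_unif beta_symp (g a0) t).
have [Uh hUh] := mp_surj Mp_meta (transv_Sp lam varpi_unif beta_symp a t).
have step U (hU : Mp (g, U)) := reduction_step gK Aa0 Aa nv hU hUv hUh.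
pose g2 := (v \o (h \o g))%VF.
have hg2 U : Mp (g, U) -> Mp (g2, Uv \o (Uh \o U)).
  by move=> hU; apply: (mp_mul Mp_meta hUv); exact: (mp_mul Mp_meta hUh hU).
have gK2 : stabB g2.
  have vt : lf_vge k 1 t.
    rewrite /t mulrC; apply: vgeM0; last exact/vgeN/(vge_varpiX varpi_unif 1).
    apply/vunit_vge0/vunitV/vunitP; last first.
      by move=> /(vge_varpiM varpi_unif); rewrite opprB addrC subrK.
    apply: (beta_dual varpi_unif B_good); last by case: Aa.
    by apply: stabB_dual => //; case: Aa0.
  apply: stabB_comp; first by apply: stabB_transv => //; apply: stabB_dual => //;
    case: Aa0.
  by apply: stabB_comp => //; apply: stabB_transv => //; case: Aa.
have [U hU] := mp_surj Mp_meta gK.1.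
have c2 := card_meet_step gK gK2 hU (hg2 U hU) (step U hU).
have q1 : (1 < #|F|)%N by exact: finNzRing_gt1.
have cg := card_meet_gt0 gK.
have lt : (card_meet g < card_meet g2)%N by rewrite c2 -{1}[card_meet g]mul1n ltn_pmul2r.
have [|j [hj hj2]] := IH g2 _ gK2.
  apply: (@leq_trans (card_x - card_meet g)) => //; apply: ltn_sub2l => //.
  exact: leq_trans lt (card_meet_le g2).
exists j.+1; split=> [|U' hU']; first by rewrite -hj c2 expnS mulnA (mulnC (card_meet g)).
by rewrite -[RHS](hj2 _ (hg2 _ hU')) (step _ hU') (exprS G); ring.
Qed.

(** * Comparison with the Weil representation *)

Lemma res_map_inv g v : stabB g -> Bs v ->
  ((res_map V g)^-1)%VF (pr v) = pr ((g^-1)%VF v).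
Proof.
move=> gK hv; have hv' := stabB_dual (stabB_inv gK) hv.
have ker0 : lker (res_map V g) == 0%VS.
  apply/lker0P => u1 u2; have [h1 <-] := qs_liftP u1; have [h2 <-] := qs_liftP u2.
  rewrite !(res_mapE V varpi_unif B_good gK) // => e.
  have := pr_stabB (stabB_inv gK) (stabB_dual gK h1) (stabB_dual gK h2) e.
  by rewrite !(Sp_Kinv beta_symp gK.1).
rewrite -{1}[v](Sp_invK beta_symp gK.1) -(res_mapE V varpi_unif B_good gK) //.
exact: lker0_lfunK.
Qed.

Lemma card_x_dim : card_x = (#|F| ^ \dim x)%N.
Proof. exact: card_vspace_pred. Qed.

Lemma card_meet_dim g : stabB g ->
  card_meet g = (#|F| ^ \dim (x :&: res_map V g @: x)%VS)%N.
Proof.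
move=> gK; rewrite -card_vspace_pred; apply: eq_card => a; rewrite !inE.
rewrite memv_cap; congr (_ && _); have [h e] := qs_liftP (a : V).
apply/idP/idP => [hx|/memv_imgP [u ux eu]].
  rewrite -[X in X \in _]e -[lift _](Sp_invK beta_symp gK.1).
  rewrite -(res_mapE V varpi_unif B_good gK); first exact: memv_img.
  exact: stabB_dual (stabB_inv gK) h.
have [hu eu'] := qs_liftP u.
suff -> : pr ((g^-1)%VF (lift a)) = u by [].
rewrite -eu' -[lift u](Sp_Kinv beta_symp gK.1); apply: pr_stabB => //.
- exact: stabB_inv.
- exact: stabB_dual.
by rewrite e -(res_mapE V varpi_unif B_good gK) // eu'.
Qed.

(** By [main_formula] every lift of the identity in [Mp] is a scalar; its square is 1, and the
    nontrivial one is not 1. *)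
Lemma mp_neg : exists2 U0, Mp (\1%VF, U0) & forall phi w, ev (U0 phi) w = - ev phi w.
Proof.
have [U0 [h0 n0 _]] := mp_kernel_other; exists U0 => //.
have oneK : stabB \1%VF.
  split; first exact: Sp_one.
  by apply/seteqP; split=> [_ [v Bv <-]|v Bv]; [rewrite lfunE | exists v; rewrite ?lfunE].
have [gamma [_ form]] := main_formula oneK h0.
have inv1 w : ((\1 : 'End(W))^-1)%VF w = w.
  by rewrite -{1}[w]id_lfunE (Sp_Kinv beta_symp (@Sp_one _ _ beta)).
have scal phi w : ev (U0 phi) w = gamma * card_x%:R * ev phi w.
  rewrite form -mulrA -sumx_const; congr (_ * _); apply: eq_sumx => a ax.
  by rewrite inv1 ev_equiv ?mulrA ?phaseVl ?mul1r //; exact: liftA.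
have := mp_kernel_sqr h0; rewrite /vac_coef scal ev_delta00 mulr1 => /eqP.
rewrite sqrf_eq1 => /orP [] /eqP e phi w; last by rewrite scal e mulN1r.
by case: n0; apply/funext => th; apply: ev_inj => u; rewrite scal e mul1r.
Qed.

Hypothesis dim_x : \dim x = half_dim V.
Variable theta : 'End(V) -> F.
Hypothesis theta_neq0 : forall g, stabB g -> theta (res_map V g) != 0.

(** The scalar in front of the sum in [finite_Weil]. *)
Definition weil_coef (g : 'End(W)) : C :=
  (omega varpi psi lam (theta (res_map V g)))^-1
  * omega varpi psi lam 1 ^ (1 - (jrank x (res_map V g))%:Z)
  * sqrt_q R k ^+ jrank x (res_map V g) * (#|F|%:R ^+ half_dim V)^-1.

Lemma sqrt_q_sqr : sqrt_q R k ^+ 2 = #|F|%:R.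
Proof.
by rewrite /sqrt_q -rmorphXn /= sqr_sqrtr ?ler0n // rmorph_nat.
Qed.

Lemma omegaE a : omega varpi psi lam a = (sqrt_q R k)^-1 * gauss psib a.
Proof. by []. Qed.

(** [theta] enters only through the sign [s]. Up to it, [weil_coef g] is the inverse of
    [gauss 1 ^ j * card_meet g], and [vac_coef_power] gives [gamma] the same square. *)
Lemma weil_coef_sign g gamma U : stabB g -> Mp (g, U) ->
  (forall phi w, ev (U phi) w =
    gamma * sumx (fun a => ph (lift a) w * ev phi ((g^-1)%VF (lift a + w)))) ->
  gamma = weil_coef g \/ gamma = - weil_coef g.
Proof.
move=> gK hU form; have [j [hj]] := vac_coef_power gK => /(_ U hU).
rewrite (vac_coef_formula gK form).
have q0 : (0 < #|F|)%N by apply: leq_trans (finNzRing_gt1 F).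
have cg : (card_meet g)%:R != 0 :> C by rewrite pnatr_eq0 -lt0n card_meet_gt0.
have qC : #|F|%:R != 0 :> C by rewrite pnatr_eq0 -lt0n.
have r0 : sqrt_q R k != 0 by apply: contraNneq qC => r; rewrite -sqrt_q_sqr r expr0n.
have g0 := gauss_one_neq0.
(* Both cardinalities in [card_meet g * q ^ j = card_x] are powers of [q], so their exponents give
   [j]. *)
have jE : jrank x (res_map V g) = j.
  have d : (\dim (x :&: res_map V g @: x)%VS + j)%N = \dim x.
    have q1 := finNzRing_gt1 F.
    by apply/eqP; rewrite -(eqn_exp2l _ _ q1) expnD -card_meet_dim // hj card_x_dim.
  by rewrite /jrank -dim_x -d addKn.
have nxE : #|F|%:R ^+ half_dim V =
  (card_meet g)%:R * sqrt_q R k ^+ j * sqrt_q R k ^+ j :> C.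
  rewrite -dim_x -natrX -card_x_dim -hj natrM natrX -sqrt_q_sqr.
  by rewrite -mulrA -exprMn -expr2.
rewrite /weil_coef jE nxE !omegaE => e.
have [s s2 es] : exists2 s : C, s ^+ 2 = 1 &
    gauss psib (theta (res_map V g)) = s * gauss psib 1.
  have [->|->] :=
    gauss_sign (two_res_neq0 res_char_neq2) res_charD res_char_neq1 (theta_neq0 gK).
    by exists 1; rewrite ?expr1n ?mul1r.
  by exists (-1); rewrite ?sqrrN ?expr1n ?mulN1r.
have s0 : s != 0.
  by apply/eqP => s0; move: s2; rewrite s0 expr0n => /esym/eqP; rewrite oner_eq0.
rewrite es; set c := (X in _ = X \/ _).
have cE : c = s / (gauss psib 1 ^+ j * (card_meet g)%:R).
  have w0 : (sqrt_q R k)^-1 * gauss psib 1 != 0 by rewrite mulf_neq0 ?invr_eq0.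
  rewrite /c expfzDr // expr1z -exprnN exprMn exprVn.
  have sV : s = s^-1 by apply: (mulIf s0); rewrite mulVf // -expr2 s2.
  rewrite {2}sV; field.
  by rewrite ?expf_neq0 ?mulf_neq0 ?s0 ?g0 ?cg ?r0.
have K0 : (card_meet g)%:R ^+ 2 * (gauss psib 1 ^+ 2) ^+ j != 0 :> C.
  by rewrite mulf_neq0 ?expf_neq0.
have : gamma ^+ 2 == c ^+ 2.
  apply/eqP/(mulIf K0); rewrite mulrA -exprMn e cE expr_div_n s2 exprMn.
  by rewrite div1r (exprAC (gauss psib 1) j 2) (mulrC (_ ^+ j)) mulVf.
by rewrite eqf_sqr => /orP [] /eqP; [left | right].
Qed.

(** Read at the coordinate [v], the sum for [U] agrees term by term with that of [finite_Weil], so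
    only the constants differ. *)
Lemma gen_Weil_formula g gamma U : stabB g ->
  (forall phi w, ev (U phi) w =
    gamma * sumx (fun a => ph (lift a) w * ev phi ((g^-1)%VF (lift a + w)))) ->
  forall (phi : H) w v, weil_coef g * U phi w v = gamma * gen_Weil psi x theta g phi w v.
Proof.
move=> gK form phi w v; have [hb eb] := qs_liftP v; set b := lift v in hb eb.
have [gS _] := gK; have g'S := Sp_inv beta_symp gS.
rewrite -{1}eb ev_phi // form /gen_Weil /finite_Weil -/(weil_coef g).
rewrite [RHS]mulrCA -[X in _ = _ * (_ * X)]/(sumx (fun a : V =>
  psib (2^-1 * betab a v) * phi ((g^-1)%VF w) (((res_map V g)^-1)%VF (v + a)))).
congr (_ * _); rewrite mulrCA; congr (_ * _); rewrite mulr_sumx; apply: eq_sumx => a ax.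
have [ha ea] := qs_liftP a; set d := lift a in ha ea *.
have hbd := dualD hb ha.
rewrite -eb -ea phase_res // -qs_prD // res_map_inv //.
rewrite ev_phi; last by apply: stabB_dual hbd; exact: stabB_inv.
rewrite phase_Sp //
  -linearD /= [X in ev _ ((g^-1)%VF X)]addrA (addrC d b) phaseDl phaseDr.
ring.
Qed.

(** The explicit operator is plus or minus a lift in [Mp], and [mp_neg] corrects the sign within
    [Mp]. *)
Theorem gen_Weil_Mp g : stabB g -> exists2 U : H -> H,
  (forall phi : H, glm_fun (U phi) = gen_Weil psi x theta g phi) & Mp (g, U).
Proof.
move=> gK; have [U hU] := mp_surj Mp_meta gK.1.
have [gamma [hn form]] := main_formula gK hU.
have g0 : gamma != 0.
  by apply/eqP => g0; move: hn; rewrite g0 !mul0r => /esym/eqP; rewrite oner_eq0.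
have wf := gen_Weil_formula gK form.
have [e|e] := weil_coef_sign gK hU form.
  exists U => // phi; apply/funext => w; apply/funext => v.
  by apply: (mulfI g0); rewrite {1}e wf.
have [U0 h0 neg] := mp_neg; exists (U0 \o U); last first.
  by have := mp_mul Mp_meta h0 hU; rewrite comp_lfun1l.
move=> phi; apply/funext => w; apply/funext => v; apply: (mulfI g0).
rewrite -wf /= -[weil_coef g]opprK -e !(ext_ev _ w v) /ext neg; ring.
Qed.

Lemma res_map_Sp g : stabB g -> Sp betab (res_map V g).
Proof.
move=> gK u v; have [hu <-] := qs_liftP u; have [hv <-] := qs_liftP v.
rewrite !(res_mapE V varpi_unif B_good gK) // !res_formE //; try exact: stabB_dual.
by rewrite gK.1.
Qed.

End Model.

Lemma symplectic_basis_dim (F : fieldType) (V : vectType F) (beta : V -> V -> F)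
    (l : nat) (e f : 'I_l -> V) : symplectic_basis beta e f ->
  \dim {:V} = (l + l)%N /\ \dim <<map e (enum 'I_l)>> = l.
Proof.
move=> ef; have := sb_basis ef; rewrite basisEfree => /and3P[fr sp _].
have := fr; rewrite cat_free => /and3P[fe _ _].
split; last by rewrite (eqnP fe) size_map size_enum_ord.
by rewrite (size_basis (sb_basis ef)) card_ord.
Qed.

Theorem mainTheorem2 (R : realType)
  (k : localField) (char_k : [pchar k] =i pred0)
  (res_char_neq2 : 2%N \notin [pchar lf_resfield k])
  (varpi : k) (varpi_unif : uniformizer varpi)
  (psi : k -> R[i]) (psi_char : unitary_character psi)
  (lam : int) (psi_cond : conductor varpi psi lam)
  (W : vectType k) (beta : {biscalar W}) (beta_symp : symplectic_form beta)
  (r : nat) (r_gt0 : (0 < r)%N) (dimW : \dim {:W} = (2 * r)%N)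
  (B : set W) (B_good : good_lattice varpi beta lam B)
  (b : quotient_space (dual_lattice varpi beta lam B) B)
  (x : {vspace b}) (x_lagr : lagrangian (res_form b) x)
  (l : nat) (e f : 'I_l -> b)
  (ef_basis : symplectic_basis (res_form b) e f)
  (e_span : <<map e (enum 'I_l)>>%VS = x)
  (theta : 'End(b) -> lf_resfield k)
  (theta_spec : is_theta (res_form b) x e f theta)
  (Mp : set ('End(W) * (glm_space psi x -> glm_space psi x)))
  (Mp_meta : is_metaplectic Mp) :
  forall g : 'End(W), lattice_stabilizer beta B g ->
    exists2 U : glm_space psi x -> glm_space psi x,
      (forall phi : glm_space psi x, glm_fun (U phi) = gen_Weil psi x theta g phi) &
      Mp (g, U).
Proof.
move=> g gK; have [dV de] := symplectic_basis_dim ef_basis.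
apply: (gen_Weil_Mp res_char_neq2 varpi_unif psi_char psi_cond beta_symp B_good
  x_lagr Mp_meta) => //.
(* The vectors [e] form half of a symplectic basis and span [x]. *)
- by rewrite /half_dim dV addnn doubleK -e_span.
- move=> h hK; apply: (theta_neq0 theta_spec).
  exact: (res_map_Sp varpi_unif beta_symp B_good).
Qed.
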